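(* Let $X$ and $Y$ be disjoint sets and let $F$ be the free group on $Z=X\cup Y$. Let $u$ be an element of the subgroup of $F$ generated by $X$ and $v$ an element of the subgroup of $F$ generated by $Y$. If $u$ and $v$ are not proper powers, then for every integer $k>1$ the group $$G(k,u,v)=\langle Z \mid [u,\underbrace{v,\dots,v}_{k}]=1\rangle$$ is residually a finite $p$-group for every prime $p$.
   Context: Commutators: $[x,y]=x^{-1}y^{-1}xy$, and $[a_1,\dots,a_{m+1}]=[[a_1,\dots,a_m],a_{m+1}]$ (left-normed). An element of a group is a proper power if it equals $w^m$ for some element $w$ of the group and some integer $m\ge 2$. A group $G$ is residually a finite $p$-group if for each $g\in G$, $g\neq 1$, there is a normal subgroup $N$ of $G$ with $g\notin N$ and $G/N$ a finite $p$-group. *)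

(* Defs.v *)
From HB Require Import structures.
From mathcomp Require Import all_boot all_classical.

Set Implicit Arguments.
Unset Strict Implicit.
Unset Printing Implicit Defensive.

Local Open Scope classical_set_scope.
Local Open Scope card_scope.
Local Open Scope quotient_scope.
Local Open Scope group_scope.

(* The finite-group library does not apply to infinite groups: groups are
   arbitrary [groupType]s, and subgroups are sets in the sense of
   [classical_sets]. *)

Section Subgroups.
Variable G : groupType.
Implicit Types (A : set G) (x y : G).

Definition is_subgroup A : Prop :=
  [/\ A 1, forall x y, A x -> A y -> A (x * y) & forall x, A x -> A x^-1].

Definition is_normal_subgroup A : Prop :=
  is_subgroup A /\ forall x y, A x -> A (x ^ y).

Definition subgroup_generated A : set G := smallest is_subgroup A.

Record normalSubgroup := NormalSubgroup {
  normal_set : set G;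
  normal_setP : is_normal_subgroup normal_set }.

Lemma normal_closure_subproof A :
  is_normal_subgroup (smallest is_normal_subgroup A).
Proof.
split; first split.
- by move=> H [[[]]].
- move=> x y Hx Hy H HA; have := conj (Hx H HA) (Hy H HA).
  by case: HA => -[[_ HM _] _] _ []; apply: HM.
- by move=> x Hx H HA; have := Hx H HA; case: HA => -[[_ _ HV] _] _; apply: HV.
- by move=> x y Hx H HA; have := Hx H HA; case: HA => -[_ HJ] _; apply: HJ.
Qed.

Definition normal_closure A : normalSubgroup :=
  NormalSubgroup (normal_closure_subproof A).

End Subgroups.

Section QuotientGroup.
Variables (G : groupType) (N : normalSubgroup G).

Definition coset_rel : rel G := fun x y => `[< normal_set N (x^-1 * y) >].

Lemma coset_rel_refl : reflexive coset_rel.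
Proof. by move=> x; apply/asboolP; rewrite mulVg; case: (normal_setP N) => -[]. Qed.

Lemma coset_rel_sym : symmetric coset_rel.
Proof.
have [[_ _ NV] _] := normal_setP N.
by move=> x y; apply/asboolP/asboolP => /NV; rewrite invgM invgK.
Qed.

Lemma coset_rel_trans : transitive coset_rel.
Proof.
have [[_ NM _] _] := normal_setP N.
move=> y x z /asboolP xy /asboolP yz; apply/asboolP.
by have := NM _ _ xy yz; rewrite -mulgA mulVKg.
Qed.

Canonical coset_equiv :=
  EquivRel coset_rel coset_rel_refl coset_rel_sym coset_rel_trans.

Definition quotientGroup := {eq_quot coset_rel}.
HB.instance Definition _ := Choice.on quotientGroup.
HB.instance Definition _ := EqQuotient.on quotientGroup.

Definition coset_class (x : G) : quotientGroup := \pi_quotientGroup x.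

Definition quot_one : quotientGroup := coset_class 1.
Definition quot_mul (a b : quotientGroup) : quotientGroup :=
  coset_class (repr a * repr b).
Definition quot_inv (a : quotientGroup) : quotientGroup :=
  coset_class (repr a)^-1.

Lemma coset_classP x y :
  coset_class x = coset_class y <-> normal_set N (x^-1 * y).
Proof.
by split=> [/eqP|xy]; [|apply/eqP]; rewrite eqmodE; [move/asboolP|apply/asboolP].
Qed.

Lemma coset_class_repr (a : quotientGroup) : coset_class (repr a) = a.
Proof. exact: reprK. Qed.

Lemma coset_class_reprP x : normal_set N (x^-1 * repr (coset_class x)).
Proof. by apply/coset_classP; rewrite coset_class_repr. Qed.

Lemma coset_classM x y :
  quot_mul (coset_class x) (coset_class y) = coset_class (x * y).
Proof.
have [[_ NM _] NJ] := normal_setP N; apply/esym/coset_classP.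
have := NM _ _ (NJ _ y (coset_class_reprP x)) (coset_class_reprP y).
by rewrite conjgE invgM !mulgA mulgK.
Qed.

Lemma coset_classV x : quot_inv (coset_class x) = coset_class x^-1.
Proof.
have [[_ _ NV] NJ] := normal_setP N; apply/esym/coset_classP.
have := NJ _ x^-1 (NV _ (coset_class_reprP x)).
by rewrite conjgE invgM !invgK !mulgA mulgK.
Qed.

Lemma quot_mulA : associative quot_mul.
Proof.
move=> a b c; rewrite -[a]coset_class_repr -[b]coset_class_repr.
by rewrite -[c]coset_class_repr !coset_classM mulgA.
Qed.

Lemma quot_mul1 : left_id quot_one quot_mul.
Proof. by move=> a; rewrite -[a]coset_class_repr coset_classM mul1g. Qed.

Lemma quot_1mul : right_id quot_one quot_mul.
Proof. by move=> a; rewrite -[a]coset_class_repr coset_classM mulg1. Qed.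

Lemma quot_mulV : left_inverse quot_one quot_inv quot_mul.
Proof.
by move=> a; rewrite -[a]coset_class_repr coset_classV coset_classM mulVg.
Qed.

Lemma quot_Vmul : right_inverse quot_one quot_inv quot_mul.
Proof.
by move=> a; rewrite -[a]coset_class_repr coset_classV coset_classM mulgV.
Qed.

HB.instance Definition _ := isGroup.Build quotientGroup
  quot_mulA quot_mul1 quot_1mul quot_mulV quot_Vmul.

End QuotientGroup.

Section FreeGroup.
Variable Z : Type.

(* The letter [(z, true)] stands for z, and [(z, false)] for its inverse. *)
Definition word := {classic seq (Z * bool)}.

Definition inv_letter (a : Z * bool) : Z * bool := (a.1, ~~ a.2).
Definition inv_word (w : seq (Z * bool)) : seq (Z * bool) :=
  rev (map inv_letter w).

Inductive free_equiv : seq (Z * bool) -> seq (Z * bool) -> Prop :=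
| free_equiv_cancel s a t :
    free_equiv (s ++ a :: inv_letter a :: t) (s ++ t)
| free_equiv_refl s : free_equiv s s
| free_equiv_sym s t : free_equiv s t -> free_equiv t s
| free_equiv_trans s t r : free_equiv s t -> free_equiv t r -> free_equiv s r.

Definition free_rel : rel word := fun s t => `[< free_equiv s t >].

Lemma free_rel_refl : reflexive free_rel.
Proof. by move=> s; apply/asboolP/free_equiv_refl. Qed.

Lemma free_rel_sym : symmetric free_rel.
Proof. by move=> s t; apply/asboolP/asboolP; apply: free_equiv_sym. Qed.

Lemma free_rel_trans : transitive free_rel.
Proof.
by move=> s t r /asboolP ts /asboolP sr; apply/asboolP/(free_equiv_trans ts).
Qed.

Canonical free_rel_equiv :=
  EquivRel free_rel free_rel_refl free_rel_sym free_rel_trans.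

Definition freeGroup := {eq_quot free_rel}.
HB.instance Definition _ := Choice.on freeGroup.
HB.instance Definition _ := EqQuotient.on freeGroup.

Definition word_class (s : seq (Z * bool)) : freeGroup :=
  \pi_freeGroup (s : word).

Definition free_one : freeGroup := word_class [::].
Definition free_mul (a b : freeGroup) : freeGroup :=
  word_class ((repr a : seq _) ++ (repr b : seq _)).
Definition free_inv (a : freeGroup) : freeGroup := word_class (inv_word (repr a)).

Lemma inv_letterK : involutive inv_letter.
Proof. by case=> z b; rewrite /inv_letter /= negbK. Qed.

Lemma inv_wordK : involutive inv_word.
Proof. by move=> s; rewrite /inv_word map_rev revK mapK //; apply: inv_letterK. Qed.

Lemma inv_word_cat s t : inv_word (s ++ t) = inv_word t ++ inv_word s.
Proof. by rewrite /inv_word map_cat rev_cat. Qed.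

Lemma free_equiv_cat2 s s' t t' :
  free_equiv s s' -> free_equiv t t' -> free_equiv (s ++ t) (s' ++ t').
Proof.
move=> ss' tt'; apply: (@free_equiv_trans _ (s' ++ t)).
  elim: ss' => [{}s a r|{}s|{}s r _|{}s r q _ IH1 _ IH2].
  - by rewrite -!catA /=; apply: free_equiv_cancel.
  - exact: free_equiv_refl.
  - exact: free_equiv_sym.
  - exact: free_equiv_trans IH1 IH2.
elim: tt' => [{}t a r|{}t|{}t r _|{}t r q _ IH1 _ IH2].
- by rewrite !catA; apply: free_equiv_cancel.
- exact: free_equiv_refl.
- exact: free_equiv_sym.
- exact: free_equiv_trans IH1 IH2.
Qed.

Lemma free_equiv_inv s t : free_equiv s t -> free_equiv (inv_word s) (inv_word t).
Proof.
elim=> [{}s a r|{}s|{}s r _|{}s r q _ IH1 _ IH2].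
- rewrite !inv_word_cat /inv_word /= inv_letterK !rev_cons -!cats1 -!catA /=.
  exact: free_equiv_cancel.
- exact: free_equiv_refl.
- exact: free_equiv_sym.
- exact: free_equiv_trans IH1 IH2.
Qed.

Lemma free_equiv_mulV s : free_equiv (s ++ inv_word s) [::].
Proof.
elim: s => [|a s IHs]; first exact: free_equiv_refl.
have -> : (a :: s) ++ inv_word (a :: s) =
          [:: a] ++ ((s ++ inv_word s) ++ [:: inv_letter a]).
  by rewrite /inv_word /= rev_cons -cats1 -catA.
apply: (@free_equiv_trans _ ([:: a] ++ ([::] ++ [:: inv_letter a]))).
  by do !apply: free_equiv_cat2 => //; apply: free_equiv_refl.
exact: (free_equiv_cancel [::] a [::]).
Qed.

Lemma word_classP s t : word_class s = word_class t <-> free_equiv s t.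
Proof.
by split=> [/eqP|st]; [|apply/eqP]; rewrite eqmodE; [move/asboolP|apply/asboolP].
Qed.

Lemma word_class_repr (a : freeGroup) : word_class (repr a) = a.
Proof. exact: reprK. Qed.

Lemma word_classM s t : free_mul (word_class s) (word_class t) = word_class (s ++ t).
Proof. by apply/word_classP/free_equiv_cat2; apply/word_classP/word_class_repr. Qed.

Lemma word_classV s : free_inv (word_class s) = word_class (inv_word s).
Proof. by apply/word_classP/free_equiv_inv/word_classP/word_class_repr. Qed.

Lemma free_mulA : associative free_mul.
Proof.
move=> a b c; rewrite -[a]word_class_repr -[b]word_class_repr.
by rewrite -[c]word_class_repr !word_classM catA.
Qed.

Lemma free_mul1 : left_id free_one free_mul.
Proof. by move=> a; rewrite -[a]word_class_repr word_classM. Qed.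

Lemma free_1mul : right_id free_one free_mul.
Proof. by move=> a; rewrite -[a]word_class_repr word_classM cats0. Qed.

Lemma free_Vmul : right_inverse free_one free_inv free_mul.
Proof.
move=> a; rewrite -[a]word_class_repr word_classV word_classM.
exact/word_classP/free_equiv_mulV.
Qed.

Lemma free_mulV : left_inverse free_one free_inv free_mul.
Proof.
move=> a; rewrite -[a]word_class_repr word_classV word_classM.
rewrite -{2}[repr a]inv_wordK; exact/word_classP/free_equiv_mulV.
Qed.

HB.instance Definition _ := isGroup.Build freeGroup
  free_mulA free_mul1 free_1mul free_mulV free_Vmul.

Definition free_gen (z : Z) : freeGroup := word_class [:: (z, true)].

End FreeGroup.

(* The group presented by the generators [Z] and the relators [R]. *)
Definition presentedGroup (Z : Type) (R : set (freeGroup Z)) : groupType :=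
  quotientGroup (normal_closure R).

(* [commg x y] is x^-1 * (y^-1 * (x * y)), and [left_normed_comm x [:: y1; y2]]
   is [[x, y1], y2]. *)
Definition left_normed_comm (G : groupType) (x : G) (s : seq G) : G :=
  foldl (@commg G) x s.

(* The identity is a proper power, as 1 = 1 ^+ 2. *)
Definition proper_power (G : groupType) (x : G) : Prop :=
  exists (w : G) (m : nat), (2 <= m)%N /\ x = w ^+ m.

Definition finite_pgroup (p : nat) (G : groupType) : Prop :=
  exists n : nat, [set: G] #= `I_(p ^ n)%N.

Definition residually_finite_pgroup (p : nat) (G : groupType) : Prop :=
  forall g : G, g <> 1 ->
    exists N : normalSubgroup G, ~ normal_set N g /\ finite_pgroup p (quotientGroup N).

(* Main.v *)
From HB Require Import structures.
From mathcomp Require Import all_boot all_classical.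
From mathcomp Require Import ssralg zmodp fingroup morphism quotient.
From mathcomp Require Import gproduct cyclic pgroup sylow center zify.
From mathcomp Require Import generic_quotient.
Require Import Defs.

(* Write H = <a, b | [a, b, ..., b] = 1>. The group G(k, u, v) is the amalgam of the
   center H with the leaves F(X) and F(Y) along u = a and v = b. The group H is an
   extension of a free group on the iterated commutators [a, b, ..., b] by <b>, which
   acts unipotently; hence H is residually a finite p-group, and <a> and <b> are
   closed in its pro-p topology. A root-free element of a free group generates its own
   centralizer, so <u> and <v> are closed as well.

   Compatible homomorphisms of the three groups to one finite p-group W are refined by
   passing to Z/p wr W: an invariant homomorphism from a kernel to Z/p extends by the
   Kaloujnine-Krasner embedding, and the two images of an amalgamated element become
   conjugate under the base. Descending along central series one reaches a W in which
   all syllables of a given reduced word stay outside the amalgamated cyclic subgroups.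

   Finally let U be a finite p-group with elements f(i, gC_i) indexed by the cosets of
   C_0 = <a> and C_1 = <b> in W. In U wr W the element s_i = (g |-> f(i, gC_i))
   centralizes C_i, so mapping H to W and the i-th leaf to the conjugate of its image
   by s_i defines a homomorphism on the amalgam. It sends a reduced word to a product
   of the f(i, gC_i)^{+-1} which is itself a reduced word, and free groups are
   residually finite p-groups. *)

Set Implicit Arguments.
Unset Strict Implicit.
Unset Printing Implicit Defensive.

Local Open Scope group_scope.

(** * Homomorphisms, wreath products and words *)

Section Hom.
Variables (G H : groupType).

Section MkHom.
Variables (f : G -> H) (fM : {morph f : x y / x * y}).

Lemma hom1_subproof : f 1 = 1.
Proof. by apply: (mulgI (f 1)); rewrite -fM !mulg1. Qed.

Definition mkhom : {multiplicative G -> H} :=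
  HB.pack f (isMultiplicative.Build G H f fM).
End MkHom.

Variable f : {multiplicative G -> H}.
Lemma hom1 : f 1 = 1.
Proof. exact/hom1_subproof/gmulfM. Qed.
Lemma homX n : {morph f : x / x ^+ n}.
Proof. by move=> x; elim: n => [|n IHn]; rewrite ?hom1 // !expgS gmulfM IHn. Qed.
Lemma homV : {morph f : x / x^-1}.
Proof. by move=> x; apply: (mulgI (f x)); rewrite -gmulfM !mulgV hom1. Qed.
Lemma homJ : {morph f : x y / x ^ y}.
Proof. by move=> x y; rewrite !conjgE !gmulfM homV. Qed.
Lemma homR : {morph f : x y / [~ x, y]}.
Proof. by move=> x y; rewrite !commgEl gmulfM homV homJ. Qed.
End Hom.

Lemma conj_hom_subproof (G : groupType) (y : G) : {morph (fun x => x ^ y) : u v / u * v}.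
Proof. by move=> u v; rewrite conjMg. Qed.
Definition conj_hom (G : groupType) (y : G) : {multiplicative G -> G} :=
  mkhom (conj_hom_subproof y).
Lemma comp_hom_subproof (G H K : groupType) (f : {multiplicative G -> H})
  (g : {multiplicative H -> K}) : {morph g \o f : u v / u * v}.
Proof. by move=> u v; rewrite /= !gmulfM. Qed.
Definition comp_hom (G H K : groupType) (g : {multiplicative H -> K})
  (f : {multiplicative G -> H}) : {multiplicative G -> K} :=
  mkhom (comp_hom_subproof f g).

Lemma hom_left_normed (G H : groupType) (f : {multiplicative G -> H}) x s :
  f (left_normed_comm x s) = left_normed_comm (f x) (map f s).
Proof.
by rewrite /left_normed_comm; elim: s x => //= y s IHs x; rewrite IHs homR.
Qed.

Section Wreath.
Variables U W : finGroupType.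

Definition wreath : Type := ({ffun W -> U} * W)%type.
HB.instance Definition _ := Finite.on wreath.

(** The top component translates the argument on the right, so a product read at coordinate [h]
    follows the walk [h], [h * x.2], ... in [W]. *)
Definition wreath_mul (x y : wreath) : wreath :=
  ([ffun h => x.1 h * y.1 (h * x.2)], x.2 * y.2).
Definition wreath_one : wreath := ([ffun=> 1], 1).
Definition wreath_inv (x : wreath) : wreath :=
  ([ffun h => (x.1 (h * x.2^-1))^-1], x.2^-1).

Lemma wreath_mulA : associative wreath_mul.
Proof.
move=> [f x] [g y] [k z]; rewrite /wreath_mul /= mulgA; congr (_, _).
by apply/ffunP => h; rewrite !ffunE !mulgA.
Qed.
Lemma wreath_mul1 : left_id wreath_one wreath_mul.
Proof.
move=> [f x]; rewrite /wreath_mul /= mul1g; congr (_, _).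
by apply/ffunP => h; rewrite !ffunE mul1g mulg1.
Qed.
Lemma wreath_mulV : left_inverse wreath_one wreath_inv wreath_mul.
Proof.
move=> [f x]; rewrite /wreath_mul /= mulVg; congr (_, _).
by apply/ffunP => h; rewrite !ffunE mulVg.
Qed.
HB.instance Definition _ :=
  Finite_isGroup.Build wreath wreath_mulA wreath_mul1 wreath_mulV.

Lemma wreathM1 (x y : wreath) h : (x * y).1 h = x.1 h * y.1 (h * x.2).
Proof. by rewrite ffunE. Qed.
Lemma wreathM2 (x y : wreath) : (x * y).2 = x.2 * y.2.
Proof. by []. Qed.
Lemma wreathV1 (x : wreath) h : (x^-1).1 h = (x.1 (h * x.2^-1))^-1.
Proof. by rewrite ffunE. Qed.
Lemma wreathV2 (x : wreath) : (x^-1).2 = x.2^-1.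
Proof. by []. Qed.
Lemma wreath11 h : (1 : wreath).1 h = 1.
Proof. by rewrite ffunE. Qed.

Lemma wreathP (x y : wreath) : x.1 =1 y.1 -> x.2 = y.2 -> x = y.
Proof. by case: x y => [f x] [g y] /= /ffunP -> ->. Qed.

Lemma wreath_top_subproof :
  {morph (fun w : W => ([ffun=> 1], w) : wreath) : x y / x * y}.
Proof. by move=> x y; apply: wreathP => // h; rewrite !ffunE mulg1. Qed.
Definition wreath_top : {multiplicative W -> wreath} :=
  mkhom wreath_top_subproof.

Definition wreath_base (f : W -> U) : wreath := ([ffun h => f h], 1).

Lemma wreath_pnat p : p.-nat #|{: U}| -> p.-nat #|{: W}| ->
  p.-nat #|{: wreath}|.
Proof.
by move=> pU pW; rewrite card_prod card_ffun pnatM pW pnatX pU.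
Qed.
End Wreath.

Section FreeHom.
Variables (T : Type) (G : groupType).

Definition letter_val (f : T -> G) (a : T * bool) : G :=
  if a.2 then f a.1 else (f a.1)^-1.
Definition word_val (f : T -> G) (w : seq (T * bool)) : G :=
  foldr (fun a x => letter_val f a * x) 1 w.

Lemma word_val_cat f s t : word_val f (s ++ t) = word_val f s * word_val f t.
Proof. by elim: s => [|a s IHs] /=; rewrite ?mul1g // IHs mulgA. Qed.

Lemma letter_val_inv f a : letter_val f (inv_letter a) = (letter_val f a)^-1.
Proof. by case: a => x [] /=; rewrite /letter_val /= ?invgK. Qed.

Lemma word_val_equiv f s t : free_equiv s t -> word_val f s = word_val f t.
Proof.
elim=> // [{}s a {}t|{}s r {}t _ -> _ ->] //.
by rewrite !word_val_cat /= letter_val_inv mulKVg.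
Qed.

Definition free_hom_fun f (x : freeGroup T) : G := word_val f (repr x).

Lemma free_hom_word f s : free_hom_fun f (word_class s) = word_val f s.
Proof. exact/word_val_equiv/word_classP/word_class_repr. Qed.

Lemma free_hom_subproof f : {morph free_hom_fun f : x y / x * y}.
Proof.
move=> x y; rewrite -[x]word_class_repr -[y]word_class_repr.
have -> : word_class (repr x) * word_class (repr y) =
  word_class ((repr x : seq _) ++ (repr y : seq _)) by exact: word_classM.
by rewrite !free_hom_word word_val_cat.
Qed.
Definition free_hom f : {multiplicative freeGroup T -> G} :=
  mkhom (free_hom_subproof f).

Lemma free_hom_class f s : free_hom f (word_class s) = word_val f s.
Proof. exact: free_hom_word. Qed.

Lemma free_hom_gen f z : free_hom f (free_gen z) = f z.
Proof. by rewrite free_hom_class /= mulg1. Qed.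
End FreeHom.

Section FreeWords.
Variable T : Type.
Implicit Types (s t : seq (T * bool)).

Lemma word_class_cat s t : word_class (s ++ t) = word_class s * word_class t.
Proof. exact/esym/word_classM. Qed.
Lemma word_class_inv s : word_class (inv_word s) = (word_class s)^-1.
Proof. exact/esym/word_classV. Qed.

Lemma free_ind (P : freeGroup T -> Prop) :
  P 1 -> (forall a x, P x -> P (word_class [:: a] * x)) -> forall x, P x.
Proof.
move=> P1 PM x; rewrite -[x]word_class_repr; elim: (repr x : seq _) => //= a s.
by rewrite -cat1s word_class_cat; apply: PM.
Qed.

Lemma word_class1 a : word_class [:: a] = letter_val (@free_gen T) a.
Proof.
by case: a => z [] //; rewrite /letter_val /free_gen /= -word_class_inv.
Qed.

Lemma hom_letter (G H : groupType) (f : {multiplicative G -> H}) (g : T -> G) a :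
  f (letter_val g a) = letter_val (f \o g) a.
Proof. by case: a => z [] //; rewrite /letter_val /= homV. Qed.

Lemma free_hom_ext (G : groupType) (f g : {multiplicative freeGroup T -> G}) :
  (forall z, f (free_gen z) = g (free_gen z)) -> f =1 g.
Proof.
move=> fg; elim/free_ind => [|a x IHx]; first by rewrite !hom1.
rewrite !gmulfM IHx word_class1 !hom_letter; congr (_ * _).
by case: a => z [] /=; rewrite /letter_val /= fg.
Qed.
End FreeWords.

(** * Free groups are residually finite p-groups *)

Lemma hom_word_val (T : Type) (G H : groupType) (phi : {multiplicative G -> H})
  (f : T -> G) w : phi (word_val f w) = word_val (phi \o f) w.
Proof. by elim: w => [|a w IHw] /=; rewrite ?hom1 // gmulfM IHw hom_letter. Qed.

Section ReducedWords.
Variable T : Type.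
Implicit Types (s t w : seq (T * bool)).

Definition non_inverse (a b : T * bool) : bool := ~~ `[< b = inv_letter a >].
Definition reduced w : bool := sorted non_inverse w.

Lemma reduced_infix s t r : reduced (s ++ t ++ r) -> reduced t.
Proof.
move=> H; have := drop_sorted (size s) H.
by rewrite drop_size_cat // => /(take_sorted (size t)); rewrite take_size_cat.
Qed.

Lemma not_reduced w : ~~ reduced w ->
  exists s a t, w = s ++ a :: inv_letter a :: t.
Proof.
elim: w => [//|a [//|b w] IHw].
rewrite /reduced /= negb_and negbK => /orP[/asboolP->|H].
  by exists [::], a, w.
by have [s [c [t ->]]] := IHw H; exists (a :: s), c, t.
Qed.

Lemma not_reducedE s a t : ~ reduced (s ++ a :: inv_letter a :: t).
Proof.
move=> /(@reduced_infix s [:: a; inv_letter a] t) /=; rewrite /reduced /=.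
by rewrite andbT => /asboolP.
Qed.

Lemma reduced_repr w : exists2 s, reduced s & (size s <= size w)%N /\
  word_class s = word_class w.
Proof.
have [n] := ubnP (size w); elim: n w => // n IHn w /ltnSE-lew.
have [rw|/not_reduced[s [a [t dw]]]] := boolP (reduced w); first by exists w.
have [|r rr [le_r e_r]] := IHn (s ++ t).
  by apply: leq_trans lew; rewrite dw !size_cat ltn_add2l /= ltnS leqnSn.
exists r => //; split.
  by apply: leq_trans le_r _; rewrite dw !size_cat leq_add2l /= -addn2 leq_addr.
by rewrite e_r dw; apply/esym/word_classP/free_equiv_cancel.
Qed.
End ReducedWords.

Section FreeResidual.
Variables (p : nat) (p_prime : prime p) (T : Type).
Implicit Types (s t w : seq (T * bool)).

Definition p_separated w := exists (U : finGroupType) (f : T -> U),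
  p.-nat #|{: U}| /\ word_val f w <> 1.

(** The direct product of the separating groups handles finitely many words at once, starting from
    the trivial group ['I_1]. *)
Lemma p_separated_all (J : eqType) (I : seq J) (w : J -> seq (T * bool)) :
  {in I, forall j, p_separated (w j)} ->
  exists (U : finGroupType) (f : T -> U),
    p.-nat #|{: U}| /\ {in I, forall j, word_val f (w j) <> 1}.
Proof.
elim: I => [_|j I IHI sepI].
  exists ('I_1 : finGroupType), (fun=> ord0); split=> //.
  by rewrite card_ord.
have [|U [f [pU fI]]] := IHI.
  by move=> i iI; apply: sepI; rewrite inE iI orbT.
have [V [g [pV gj]]] := sepI j (mem_head _ _).
exists (U * V)%type, (fun z => (f z, g z)); split; first by rewrite card_prod pnatM pU.
have m1 : {morph (fun x : U * V => x.1) : x y / x * y} by [].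
have m2 : {morph (fun x : U * V => x.2) : x y / x * y} by [].
move=> i; rewrite inE => /predU1P[->|iI] e1.
  by apply: gj; have := hom_word_val (mkhom m2) (fun z => (f z, g z)) (w j) => <-; rewrite e1.
by apply: (fI i iI); have := hom_word_val (mkhom m1) (fun z => (f z, g z)) (w i) => <-; rewrite e1.
Qed.

Section Edge.
Variables (U : finGroupType) (f : T -> U) (z0 : T) (src : U).

(** At coordinate [h], the base component of a word counts mod [p], with sign, how often its path
    from [h] in the Cayley graph of [U] traverses the edge labelled [z0] leaving [src]. An inverse
    letter runs backwards, so its endpoint is the one compared with [src]. *)
Definition edge_fun (z : T) : wreath 'F_p U :=
  ([ffun h => if `[< z = z0 >] && (h == src) then 1%R else 0%R], f z).

Lemma letter_edge2 a : (letter_val edge_fun a).2 = letter_val f a.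
Proof. by case: a => z []. Qed.

Lemma letter_edge1 a h :
  ~ (a.1 = z0 /\ (if a.2 then h else h * letter_val f a) = src) ->
  (letter_val edge_fun a).1 h = 1.
Proof.
case: a => z [] /=; rewrite /letter_val /= ffunE.
  by case: asboolP => [->|] //; case: (h =P src) => [->|] // [].
rewrite ffunE; case: asboolP => [-> H|_ _]; last by rewrite /= invg1.
by case: (h * (f z0)^-1 =P src) => [e|_]; [case: H|rewrite invg1].
Qed.

Lemma word_edge1 w h :
  (forall s a t, w = s ++ a :: t -> a.1 = z0 ->
    (if a.2 then h * word_val f s else h * word_val f (rcons s a)) <> src) ->
  (word_val edge_fun w).1 h = 1.
Proof.
elim: w h => [|a w IHw] h H /=; first by rewrite ffunE.
rewrite wreathM1 letter_edge1 ?mul1g ?letter_edge2; last first.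
  by have := H [::] a w erefl; rewrite /= !mulg1 => H' [] /H'.
apply: IHw => s b t dw bz; have := H (a :: s) b t; rewrite /= dw !mulgA.
by move=> /(_ erefl bz).
Qed.
End Edge.

(* The prefixes of a shortest word read in a finite p-group separating its proper
   subwords trace a simple cycle, which the mod-p homology cover opens. *)
Lemma reduced_p_separated w : reduced w -> w <> [::] -> p_separated w.
Proof.
have [n] := ubnP (size w); elim: n w => // n IHn w /ltnSE-lew rw wn0.
(* Pairs (start, length) ranging over the nonempty proper factors of [w]; by induction a single [U]
   keeps them all nontrivial. *)
pose I := [seq ij <- [seq (i, j) | i <- iota 0 (size w).+1, j <- iota 0 (size w).+1]
          | (0 < size (take ij.2 (drop ij.1 w)) < size w)%N].
have [|U [f [pU fI]]] := @p_separated_all _ I (fun ij => take ij.2 (drop ij.1 w)).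
  move=> ij; rewrite mem_filter => /andP[/andP[sz1 sz2] _].
  apply: IHn; first exact: leq_trans sz2 lew.
    by apply: take_sorted; apply: drop_sorted.
  by move=> e; rewrite e in sz1.
have D x y t : w = x ++ y ++ t -> y <> [::] -> (size y < size w)%N ->
    word_val f y <> 1.
  move=> dw yn0 szy; have := fI (size x, size y).
  have E : take (size y) (drop (size x) w) = y.
    by rewrite dw drop_size_cat // take_size_cat.
  move=> /(_ _)/=; rewrite E; apply; rewrite mem_filter [_.1]/= [_.2]/= E szy andbT.
  apply/andP; split; first by case: (y) yn0.
  by apply/allpairsP; exists (size x, size y); rewrite !mem_iota /= add0n ltnS dw !size_cat ?leq_addr // addnCA leq_addr.
case: w => [//|[z0 e0] w] in rw lew wn0 D {I fI} *.
(* The source of the edge traversed by the first letter: an inverse letter runs backwards from 1, so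
   the source is the vertex it reaches. *)
pose src : U := if e0 then 1 else letter_val f (z0, e0).
exists (wreath 'F_p U : finGroupType), (edge_fun f z0 src); split.
  by rewrite wreath_pnat // card_Fp // pnat_id.
move=> /(congr1 (fun x : wreath _ _ => x.1 1)) /=.
rewrite wreathM1 wreath11 letter_edge2 mul1g word_edge1 ?mulg1; last first.
  move=> s [z e] t + /= zE; rewrite {z}zE => dw; rewrite {}dw in rw D wn0 *.
  set a0 := (z0, e0) in D wn0 rw *.
  (* A second passage through the edge, in either direction, makes a nonempty proper factor trivial
     in [U] or exhibits a cancelling pair in [w]. *)
  rewrite /src; clear lew; case: e e0 @src @a0 rw D wn0 => [] [] src a0 rw D wn0 H.
  - apply: (D [::] (a0 :: s) ((z0, true) :: t)) => //.
    by rewrite /= size_cat /=; lia.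
  - case: s => [|b s] in rw D wn0 H *; first exact: (@not_reducedE _ [::] a0 t).
    apply: (D [:: a0] (b :: s) ((z0, true) :: t)) => //.
      by rewrite /= size_cat /=; lia.
    by move: H; rewrite -[RHS]mulg1 => /mulgI.
  - case: t => [|b t] in rw D wn0 *; last first.
      apply: (D [::] (a0 :: rcons s (z0, false)) (b :: t)) => //.
        by rewrite /= cat_rcons.
      by rewrite /= size_cat size_rcons /=; lia.
    case: s => [|b s] in rw D wn0 H *; first exact: (@not_reducedE _ [::] a0 [::]).
    apply: (D [:: a0] (b :: s) [:: (z0, false)]) => //.
      by rewrite /= size_cat /=; lia.
    have : (word_val f (b :: s)) ^ (letter_val f a0)^-1 = 1.
      rewrite conjgE invgK mulgA -H -cats1 word_val_cat /= mulg1.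
      by rewrite -!mulgA.
    by move/eqP; rewrite conjg_eq1 => /eqP.
  - apply: (D [:: a0] (rcons s (z0, false)) t) => //.
    + by rewrite /= cat_rcons.
    + by case: (s).
    + by rewrite /= size_cat size_rcons /=; lia.
    + by move: H; rewrite -[RHS]mulg1 => /mulgI.
have F10 : 1%R != 0%R :> 'F_p by exact: GRing.oner_neq0.
rewrite /letter_val /src {src lew rw D wn0}; case: e0 => /=.
  by rewrite ffunE asboolT // eqxx => /eqP; rewrite (negPf F10).
rewrite ffunE mul1g ffunE asboolT // eqxx /= => /eqP.
by rewrite -[_ == _]/((- 1)%R == 0%R :> 'F_p) GRing.oppr_eq0 (negPf F10).
Qed.

Lemma free_residually_p (x : freeGroup T) : x <> 1 ->
  exists (U : finGroupType) (f : {multiplicative freeGroup T -> U}),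
    p.-nat #|{: U}| /\ f x <> 1.
Proof.
rewrite -[x]word_class_repr; have [s rs [_ <-]] := reduced_repr (repr x).
move=> s1; have [|U [f [pU fs]]] := reduced_p_separated rs.
  by move=> s0; apply: s1; rewrite s0.
by exists U, (free_hom f); rewrite free_hom_class.
Qed.
End FreeResidual.

(** * Uniqueness of reduced words *)

Section Uniqueness.
Variable T : Type.
Implicit Types (s t w : seq (T * bool)).

(** A nonempty reduced word already survives in a finite 2-group; the choice of the prime 2 is
    arbitrary. *)
Lemma reduced_neq1 w : reduced w -> word_class w = 1 -> w = [::].
Proof.
move=> rw w1; apply/not_notP => wn0.
have [U [f [_ fw]]] := reduced_p_separated (isT : prime 2) rw wn0.
by apply: fw; rewrite -(free_hom_class f) w1 hom1.
Qed.

Lemma reduced_inv w : reduced (inv_word w) = reduced w.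
Proof.
rewrite /reduced /inv_word rev_sorted sorted_map.
apply/eq_sorted => a b /=; rewrite /non_inverse; congr (~~ _).
by apply: asbool_equiv_eq; rewrite inv_letterK; split=> ->.
Qed.

Lemma reduced_cat2 s a b t : reduced (rcons s a) -> reduced (b :: t) ->
  b <> inv_letter a -> reduced (rcons s a ++ b :: t).
Proof.
move=> sa bt ab; case: s sa => [|c s] /=.
  by move=> _; move: bt; rewrite /reduced /= => ->; rewrite andbT; apply/asboolP.
rewrite /reduced /= cat_path last_rcons => -> /=.
by move: bt; rewrite /reduced /= => ->; rewrite andbT; apply/asboolP.
Qed.

(** Equal last letters are removed; different ones make [s ++ inv_word t] a nonempty reduced word
    representing 1. *)
Lemma reduced_uniq s t : reduced s -> reduced t ->
  word_class s = word_class t -> s = t.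
Proof.
elim/last_ind: s t => [|s a IHs] t; first by move=> _ rt /esym/(reduced_neq1 rt).
case/lastP: t => [|t b] rs rt; first by move/(reduced_neq1 rs).
have [->|neq_ab] := pselect (a = b).
  rewrite -!cats1 !word_class_cat => /mulIg/IHs -> //.
    by move: rs; rewrite -cats1 => /(@reduced_infix _ [::]).
  by move: rt; rewrite -cats1 => /(@reduced_infix _ [::]).
move=> e; have : reduced (rcons s a ++ inv_word (rcons t b)).
  move: rt; rewrite -reduced_inv; rewrite /inv_word map_rcons rev_rcons => rt.
  by apply: reduced_cat2 => // /(can_inj (@inv_letterK _)) /esym.
move/reduced_neq1; rewrite word_class_cat word_class_inv e mulgV => /(_ erefl).
by case: (s).
Qed.
End Uniqueness.

(** * Centralizers in free groups *)

(** Membership in the cyclic subgroup of [x], an integer exponent being a difference of two natural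
    numbers. *)
Definition in_cycle (G : groupType) (x y : G) : Prop :=
  exists n m : nat, y = x ^+ n * x ^- m.

Section Cycle.
Variable G : groupType.
Implicit Types x y z : G.

Lemma in_cycle_expg x n : in_cycle x (x ^+ n).
Proof. by exists n, 0%N; rewrite expg0 invg1 mulg1. Qed.
Lemma in_cycle_expVg x n : in_cycle x (x ^- n).
Proof. by exists 0%N, n; rewrite expg0 mul1g. Qed.
Lemma in_cycle1 x : in_cycle x 1.
Proof. exact: (in_cycle_expg x 0). Qed.

Lemma in_cycle_commute x y : in_cycle x y -> commute x y.
Proof.
move=> [n [m ->]]; apply: commuteM; first exact: commuteX.
exact/commuteV/commuteX.
Qed.

Lemma in_cycleV x y : in_cycle x y -> in_cycle x y^-1.
Proof. by move=> [n [m ->]]; exists m, n; rewrite invgM invgK. Qed.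

Lemma in_cycleM x y z : in_cycle x y -> in_cycle x z -> in_cycle x (y * z).
Proof.
move=> [n [m ->]] [k [l ->]]; exists (n + k)%N, (m + l)%N.
have c i j : commute (x ^- i) (x ^+ j).
  exact/commute_sym/commuteV/commuteX2/commute_refl.
have cV : commute (x ^- m) (x ^- l) by exact/commuteV/c.
by rewrite !expgnDr invgM -cV -!mulgA; congr (_ * _); rewrite !mulgA c.
Qed.

Lemma in_cycle_conj x y z : in_cycle (x ^ z) (y ^ z) -> in_cycle x y.
Proof.
move=> [n [m e]]; exists n, m; apply: (@conjg_inj _ z).
by rewrite e conjMg conjVg !conjXg.
Qed.

Lemma proper_power_conj x z : proper_power (x ^ z) -> proper_power x.
Proof.
move=> [w [m [m2 e]]]; exists (w ^ z^-1), m; split=> //.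
by rewrite -conjXg -e conjgK.
Qed.

Lemma not_proper_power_expg_neq1 x n : ~ proper_power x -> (0 < n)%N -> x ^+ n <> 1.
Proof.
by move=> xpp n0 e; apply: xpp; exists x, n.+1; rewrite ltnS n0 expgS e mulg1.
Qed.
End Cycle.

Lemma hom_in_cycle (G H : groupType) (f : {multiplicative G -> H}) x y :
  in_cycle x y -> in_cycle (f x) (f y).
Proof. by move=> [n [m ->]]; exists n, m; rewrite gmulfM homV !homX. Qed.

(** Euclid's algorithm on the lengths: the shorter word is a prefix of the longer one and is
    stripped from it. *)
Lemma cat_commute (T : Type) (s t : seq T) : s ++ t = t ++ s ->
  exists r i j, s = flatten (nseq i r) /\ t = flatten (nseq j r).
Proof.
have [n] := ubnP (size s + size t); elim: n s t => // n IHn s t.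
have base (u : seq T) : exists r i j,
    u = flatten (nseq i r) /\ [::] = flatten (nseq j r).
  by exists u, 1%N, 0%N; rewrite /= cats0.
case: s => [|a s]; first by have [r [i [j [-> ?]]]] := base t; exists r, j, i.
case: t => [|b t]; first by move=> *; apply: base.
move: (a :: s) (b :: t) (isT : 0 < size (a :: s))%N (isT : 0 < size (b :: t))%N.
move=> {a b}s {}t s0 t0 szn e.
have [le_st|/ltnW le_ts] := leqP (size s) (size t).
  have dt : t = s ++ drop (size s) t.
    rewrite -{1}[t](cat_take_drop (size s)); congr (_ ++ _).
    by have := congr1 (take (size s)) e; rewrite take_size_cat // takel_cat.
  have [||r [i [j [ds dt']]]] := IHn s (drop (size s) t).
  - by rewrite size_drop; lia.
  - have := e; rewrite {1 2}dt -catA => /(congr1 (drop (size s))).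
    by rewrite !drop_size_cat.
  exists r, i, (i + j)%N; split=> //.
  by rewrite {1}dt nseqD flatten_cat -dt' -ds.
have ds : s = t ++ drop (size t) s.
  rewrite -{1}[s](cat_take_drop (size t)); congr (_ ++ _).
  by rewrite -(takel_cat t le_ts) e take_size_cat.
have [||r [i [j [ds' dt]]]] := IHn (drop (size t) s) t.
- by rewrite size_drop; lia.
- have := e; rewrite {1 2}ds -catA => /(congr1 (drop (size t))).
  by rewrite !drop_size_cat.
exists r, (j + i)%N, j; split=> //.
by rewrite {1}ds nseqD flatten_cat -ds' -dt.
Qed.

Section Centralizer.
Variable T : Type.
Implicit Types (s t w y d : seq (T * bool)).

Lemma word_class_flatten n w :
  word_class (flatten (nseq n w)) = word_class w ^+ n.
Proof. by elim: n => [|n IHn] //=; rewrite word_class_cat IHn expgS. Qed.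

Lemma reduced_commute y d : reduced (y ++ d) -> d <> [::] ->
  commute (word_class y) (word_class d) ->
  exists (r : freeGroup T) i j, word_class y = r ^+ i /\ word_class d = r ^+ j.
Proof.
move=> ryd dn0 cyd.
have e : word_class (d ++ y) = word_class (y ++ d).
  by rewrite !word_class_cat cyd.
have [rdy|/not_reduced[s [a [t st]]]] := boolP (reduced (d ++ y)).
  have [r [i [j [-> ->]]]] := cat_commute (reduced_uniq ryd rdy (esym e)).
  by exists (word_class r), i, j; rewrite !word_class_flatten.
have [r rr [szr er]] := reduced_repr (s ++ t).
have : r = y ++ d.
  apply: reduced_uniq => //; rewrite er -e st.
  exact/esym/word_classP/free_equiv_cancel.
move/(congr1 size); move/(congr1 size): st szr.
by rewrite !size_cat /=; lia.
Qed.

Lemma inv_letter_neq (a : T * bool) : a <> inv_letter a.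
Proof. by case: a => z [] []. Qed.

Lemma free_centralizer_word w x : reduced w -> ~ proper_power (word_class w) ->
  commute x (word_class w) -> in_cycle (word_class w) x.
Proof.
have [n] := ubnP (size w); elim: n w x => // n IHn w x /ltnSE-szw rw wpp.
have npp1 (z : freeGroup T) : z = 1 -> proper_power z.
  by move=> ->; exists 1, 2%N; rewrite expg1n.
case: w => [|a w] in szw rw wpp *; first by case: wpp; apply: npp1.
(* If the last letter is inverse to the first, conjugating by the first letter shortens [w];
   otherwise [w] is cyclically reduced. *)
have [la|la] := pselect (last a w = inv_letter a).
  case/lastP: w => [|m b] in szw rw wpp la *; first by case: (@inv_letter_neq a).
  rewrite last_rcons in la; rewrite {b}la in szw rw wpp *.
  have e : word_class m = word_class (a :: rcons m (inv_letter a)) ^ word_class [:: a].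
    have -> : word_class (a :: rcons m (inv_letter a)) =
        word_class [:: a] * (word_class m * (word_class [:: a])^-1).
      by rewrite -word_class_inv -!word_class_cat cats1.
    by rewrite conjgE !mulgA mulgVK mulVg mul1g.
  move=> cx; apply: (@in_cycle_conj _ _ _ (word_class [:: a])); rewrite -e.
  apply: IHn.
  - by move: szw; rewrite /= size_rcons; lia.
  - by move: rw; rewrite -cats1 -cat1s => /reduced_infix.
  - by rewrite e => /proper_power_conj.
  - by rewrite e /commute -!conjMg cx.
rewrite -[x]word_class_repr; have [y ry [_ <-]] := reduced_repr (repr x).
case/lastP: y => [|y b] in ry *; first by move=> _; apply: in_cycle1.
(* Without cancellation both words are powers of one element [r], and root-freeness makes [d] equal
   to [r] itself. *)
have root (d : seq (T * bool)) : d <> [::] -> reduced (rcons y b ++ d) ->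
    ~ proper_power (word_class d) ->
    commute (word_class (rcons y b)) (word_class d) ->
    exists i, word_class (rcons y b) = word_class d ^+ i.
  move=> dn0 rd dpp /(reduced_commute rd dn0)[r [i [j [-> dE]]]].
  case: j dE => [/npp1//|[->|j dE]]; first by exists i.
  by case: dpp; exists r, j.+2.
(* As [w] is cyclically reduced, the last letter of [y] cannot cancel against both [w] and its
   inverse, so [root] applies to one of them. *)
have [ab|ab] := pselect (a = inv_letter b); last first.
  move=> cx; have wn0 : a :: w <> [::] by [].
  have [i ->] := root _ wn0 (reduced_cat2 ry rw ab) wpp cx.
  exact: in_cycle_expg.
move=> cx; have invpp : ~ proper_power (word_class (inv_word (a :: w))).
  rewrite word_class_inv => -[r [j [j2 e]]]; apply: wpp.
  by exists r^-1, j; rewrite expVgn -e invgK.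
have [||//||i ->] := root (inv_word (a :: w)).
- by move/(congr1 size); rewrite /inv_word size_rev.
- have := rw; rewrite -reduced_inv lastI /inv_word map_rcons rev_rcons => rw'.
  apply: reduced_cat2 => [//|//|e]; apply: la.
  by apply: (can_inj (@inv_letterK T)); rewrite e -ab inv_letterK.
- by rewrite word_class_inv; apply: commuteV.
by rewrite word_class_inv expVgn; apply: in_cycle_expVg.
Qed.

Lemma free_centralizer (u x : freeGroup T) : ~ proper_power u ->
  commute x u -> in_cycle u x.
Proof.
rewrite -[u]word_class_repr; have [w rw [_ <-]] := reduced_repr (repr u).
exact: free_centralizer_word.
Qed.
End Centralizer.

Section FreeSeparability.
Variables (p : nat) (p_prime : prime p) (T : Type).

(** Outside its cycle nothing commutes with [u], so a finite p-group in which [[~ x, u]] survives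
    does the separation. *)
Lemma free_cycle_p_separable (u x : freeGroup T) : ~ proper_power u ->
  ~ in_cycle u x ->
  exists (U : finGroupType) (f : {multiplicative freeGroup T -> U}),
    p.-nat #|{: U}| /\ ~ in_cycle (f u) (f x).
Proof.
move=> upp xu; have [|U [f [pU fx]]] := @free_residually_p _ p_prime _ [~ x, u].
  by move/eqP/commgP/(free_centralizer upp).
exists U, f; split=> // /in_cycle_commute/commute_sym/commgP/eqP.
by rewrite -homR => /fx.
Qed.

(** Sending every generator to 1 in Z/m kills all [m]-th powers but no generator. *)
Lemma free_gen_not_proper_power (z : T) : ~ proper_power (free_gen z).
Proof.
move=> [w [m [m2 e]]].
pose f := free_hom (fun _ : T => 1%R : 'Z_m).
have /(congr1 f) := e; rewrite homX free_hom_gen.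
have -> : f w ^+ m = 1.
  suff: (f w *+ m = 0)%R by [].
  by rewrite -GRing.mulr_natl pchar_Zp // GRing.mul0r.
by move/eqP; rewrite -[_ == _]/(1%R == 0%R :> 'Z_m) GRing.oner_eq0.
Qed.
End FreeSeparability.

(** * The Engel group on two generators *)

Section Presented.
Variables (Z : Type) (R : set (freeGroup Z)).

Lemma pres_class_subproof :
  {morph (fun x => coset_class (normal_closure R) x : presentedGroup R) : x y / x * y}.
Proof. by move=> x y; apply/esym/coset_classM. Qed.
Definition pres_class : {multiplicative freeGroup Z -> presentedGroup R} :=
  mkhom pres_class_subproof.

Lemma pres_class_rel r : R r -> pres_class r = 1.
Proof.
move=> Rr; rewrite -(hom1 pres_class); apply/esym/coset_classP.
by rewrite invg1 mul1g => N [_]; apply.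
Qed.

Lemma pres_class_onto x : exists y, x = pres_class y.
Proof. by exists (repr x); rewrite /= coset_class_repr. Qed.

Lemma pres_hom (G : groupType) (f : {multiplicative freeGroup Z -> G}) :
  (forall r, R r -> f r = 1) ->
  exists g : {multiplicative presentedGroup R -> G}, forall x, g (pres_class x) = f x.
Proof.
move=> fR; have kerN : is_normal_subgroup [set x | f x = 1]%classic.
  split; [split=> /= [|x y fx fy|x fx]|move=> x y /= fx].
  - exact: hom1.
  - by rewrite gmulfM fx fy mulg1.
  - by rewrite homV fx invg1.
  - by rewrite homJ fx conj1g.
have fE x : f (repr (pres_class x)) = f x.
  have /(_ _ (conj kerN fR)) /= := coset_class_reprP (normal_closure R) x.
  by rewrite gmulfM homV => /mulg1_eq; rewrite invgK => ->.
have gM : {morph (fun x : presentedGroup R => f (repr x)) : x y / x * y}.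
  move=> x y; have [x' ->] := pres_class_onto x; have [y' ->] := pres_class_onto y.
  by rewrite -gmulfM !fE gmulfM.
by exists (mkhom gM).
Qed.
End Presented.

Section SubgroupSets.
Variables (T : Type) (G : groupType).

Lemma free_hom_sub (A : set G) (f : {multiplicative freeGroup T -> G}) :
  is_subgroup A -> (forall z, A (f (free_gen z))) -> forall x, A (f x).
Proof.
move=> [A1 AM AV] Agen; elim/free_ind => [|a x IHx]; first by rewrite hom1.
rewrite gmulfM; apply: AM => //; rewrite word_class1 hom_letter.
by case: a => z []; [apply: Agen|apply/AV/Agen].
Qed.
End SubgroupSets.

Lemma iter_comm_rec (G : groupType) (a b : G) i :
  left_normed_comm a (nseq i.+1 b) = [~ left_normed_comm a (nseq i b), b].
Proof. by rewrite -addn1 nseqD /left_normed_comm foldl_cat. Qed.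

Section EngelGroup.
Variable k : nat.

(** [true] stands for a and [false] for b. With [k.+1] commutations the relator is [c k.+1], which
    leaves [c 0], ..., [c k], indexed by ['I_k.+1], to generate the base. *)
Definition engel_relator : freeGroup bool :=
  left_normed_comm (free_gen true) (nseq k.+1 (free_gen false)).
Definition engelGroup := presentedGroup [set engel_relator]%classic.

Definition engel_a : engelGroup := pres_class _ (free_gen true).
Definition engel_b : engelGroup := pres_class _ (free_gen false).
Local Notation a := engel_a.
Local Notation b := engel_b.
Definition engel_c i : engelGroup := left_normed_comm a (nseq i b).
Local Notation c := engel_c.

Lemma engel_c_last : c k.+1 = 1.
Proof.
rewrite -[RHS](@pres_class_rel _ [set engel_relator]%classic engel_relator) //.
by rewrite hom_left_normed map_nseq.
Qed.

Lemma engel_cJ i : c i ^ b = c i * c i.+1.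
Proof. by rewrite [c i.+1]iter_comm_rec commgEl mulKVg. Qed.

Lemma engel_hom (G : groupType) (x y : G) :
  left_normed_comm x (nseq k.+1 y) = 1 ->
  exists f : {multiplicative engelGroup -> G}, f a = x /\ f b = y.
Proof.
move=> xy1; pose f := free_hom (fun i : bool => if i then x else y).
have [|g gE] := @pres_hom _ [set engel_relator]%classic _ f.
  by move=> r ->; rewrite hom_left_normed map_nseq !free_hom_gen.
by exists g; rewrite !gE !free_hom_gen.
Qed.

Definition engel_iota : {multiplicative freeGroup 'I_k.+1 -> engelGroup} :=
  free_hom (fun i : 'I_k.+1 => c i).
Local Notation iota := engel_iota.

Lemma engel_iota0 : iota (free_gen ord0) = a.
Proof. by rewrite free_hom_gen. Qed.

Definition engel_base : set engelGroup :=
  [set h | exists f, h = iota f]%classic.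

Lemma engel_base_subgroup : is_subgroup engel_base.
Proof.
split; first by exists 1; rewrite hom1.
  by move=> _ _ [f ->] [g ->]; exists (f * g); rewrite gmulfM.
by move=> _ [f ->]; exists f^-1; rewrite homV.
Qed.

Lemma engel_base_c i : (i <= k.+1)%N -> engel_base (c i).
Proof.
rewrite leq_eqVlt => /predU1P[->|ik]; first by exists 1; rewrite engel_c_last hom1.
by exists (free_gen (Ordinal ik)); rewrite free_hom_gen.
Qed.

Lemma engel_baseJ_gen y : (forall i, (i < k.+1)%N -> engel_base (c i ^ y)) ->
  forall h, engel_base h -> engel_base (h ^ y).
Proof.
move=> By _ [f ->].
apply: (@free_hom_sub _ _ engel_base (comp_hom (conj_hom y) iota)).
  exact: engel_base_subgroup.
by move=> i; rewrite [X in engel_base X]/(iota (free_gen i) ^ y) free_hom_gen; apply: By.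
Qed.

(** Conjugation by [b] is read off [engel_cJ]. For the inverse of [b] the same relation is solved
    for [c i], descending from [c k.+1 = 1]. *)
Lemma engel_baseJ h z : in_cycle b z -> engel_base h -> engel_base (h ^ z).
Proof.
have [_ BM BV] := engel_base_subgroup.
have Bb h' : engel_base h' -> engel_base (h' ^ b).
  move: h'; apply: engel_baseJ_gen => i ik; rewrite engel_cJ.
  by apply: BM; apply: engel_base_c => //; apply: ltnW.
have BbV h' : engel_base h' -> engel_base (h' ^ b^-1).
  move: h'; apply: engel_baseJ_gen => i /ltnW ik.
  rewrite -(subKn ik); elim: (k.+1 - i)%N => [|j IHj].
    by rewrite subn0 engel_c_last conj1g; exists 1; rewrite hom1.
  have [jk|jk] := leqP k.+1 j.
    by have -> : (k.+1 - j.+1 = k.+1 - j)%N by lia.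
  have -> : c (k.+1 - j.+1) ^ b^-1 =
      c (k.+1 - j.+1) * (c (k.+1 - j) ^ b^-1)^-1.
    apply: (canRL (mulgK _)); rewrite -conjMg.
    have -> : (k.+1 - j = (k.+1 - j.+1).+1)%N by lia.
    by rewrite -engel_cJ conjgK.
  by apply: BM; [apply: engel_base_c; lia|apply: BV].
move=> [n [m ->]]; rewrite -expVgn conjgM.
have BX n' h' : engel_base h' -> engel_base (h' ^ (b ^+ n')).
  by elim: n' h' => [|n' IHn] h'; rewrite ?conjg1 // expgS conjgM => /Bb/IHn.
have BXV n' h' : engel_base h' -> engel_base (h' ^ (b^-1 ^+ n')).
  by elim: n' h' => [|n' IHn] h'; rewrite ?conjg1 // expgS conjgM => /BbV/IHn.
by move=> /BX/BXV; apply.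
Qed.

Lemma engel_normal_form (h : engelGroup) :
  exists f z, in_cycle b z /\ h = iota f * z.
Proof.
pose A : set engelGroup :=
  [set h | exists f z, in_cycle b z /\ h = iota f * z]%classic.
have subA : is_subgroup A.
  split; first by exists 1, 1; split; [apply: in_cycle1|rewrite hom1 mulg1].
    move=> _ _ [f [z [bz ->]]] [g [t [bt ->]]].
    have [|g' e] := @engel_baseJ (iota g) z^-1 (in_cycleV bz); first by exists g.
    exists (f * g'), (z * t); split; first exact: in_cycleM.
    by rewrite gmulfM -e conjgE invgK !mulgA mulgVK.
  move=> _ [f [z [bz ->]]].
  have [|g' e] := @engel_baseJ (iota f^-1) z bz; first by exists f^-1.
  exists g', z^-1; split; first exact: in_cycleV.
  by rewrite -e conjgE invgM homV !mulgA mulgK.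
have [x ->] := pres_class_onto h.
apply: (@free_hom_sub _ _ A (pres_class _) subA) => -[].
  exists (free_gen ord0), 1; split; first exact: in_cycle1.
  by rewrite mulg1 engel_iota0.
exists 1, b; split; first exact: (in_cycle_expg b 1).
by rewrite hom1 mul1g.
Qed.
End EngelGroup.

(** * The unipotent shift and finite p-quotients of the Engel group *)

Section Shift.
Variables (U : groupType) (k : nat) (y : 'I_k.+1 -> U).

(** The value of [c i ^ (b ^+ t)] when each [c j] is sent to [y j]; indices above [k] give 1. *)
Fixpoint shift_seq (t i : nat) : U :=
  if t is t'.+1 then shift_seq t' i * shift_seq t' i.+1
  else if insub i is Some j then y j else 1.

Lemma shift_seq_out t i : (k < i)%N -> shift_seq t i = 1.
Proof.
elim: t i => [|t IHt] i ki /=; last by rewrite !IHt ?mulg1 // ltnW.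
by rewrite insubN // -leqNgt.
Qed.

Lemma shift_seq0 (i : 'I_k.+1) : shift_seq 0 i = y i.
Proof. by rewrite /= valK. Qed.

(* The action [y_i |-> y_i y_(i+1)] is unipotent, so its orbits on tuples of a finite p-group
   have p-power length. *)
Lemma shift_seq_period p u : (forall x : U, x ^+ (p ^ u) = 1) ->
  exists e, forall t i, shift_seq (p ^ e + t) i = shift_seq t i.
Proof.
move=> Up; suff /(_ k.+1)[e He] : forall j, exists e, forall t i,
    (k.+1 - j <= i)%N -> shift_seq (p ^ e + t) i = shift_seq t i.
  by exists e => t i; apply: He; rewrite subnn.
elim=> [|j [e IHj]].
  by exists 0%N => t i; rewrite subn0 => ki; rewrite !shift_seq_out.
exists (e + u)%N; suff H0 : forall i, (k.+1 - j.+1 <= i)%N ->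
    shift_seq (p ^ (e + u)) i = shift_seq 0 i.
  elim=> [|t IHt] i ji; first by rewrite addn0 H0.
  by rewrite addnS /= !IHt // leqW.
move=> i ji; have [ji'|ij] := leqP (k.+1 - j) i.
  rewrite expnD; elim: (p ^ u)%N => [|n IHn]; first by rewrite muln0.
  by rewrite mulnS IHj.
(* One period of the sequence of index [i.+1] multiplies the term of index [i] by [M], so [p ^ u]
   periods multiply it by [M ^+ (p ^ u) = 1]. *)
pose M := \prod_(r < p ^ e) shift_seq r i.+1.
have IHi t : shift_seq (p ^ e + t) i.+1 = shift_seq t i.+1.
  by apply: IHj; lia.
have Mt n : shift_seq (n * p ^ e) i = shift_seq 0 i * M ^+ n.
  elim: n => [|n IHn]; first by rewrite mul0n mulg1.
  rewrite mulSn addnC expgSr mulgA -IHn /M.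
  suff H r : shift_seq (n * p ^ e + r) i =
      shift_seq (n * p ^ e) i * \prod_(j < r) shift_seq j i.+1 by exact: H.
  elim: r => [|r IHr]; first by rewrite addn0 big_ord0 mulg1.
  rewrite addnS big_ord_recr /= mulgA -IHr; congr (_ * _).
  by elim: (n) => [//|m IHm]; rewrite mulSn -addnA IHi.
by rewrite expnD mulnC Mt Up mulg1.
Qed.
End Shift.

Lemma finite_p_exponent (p : nat) (U : finGroupType) : p.-nat #|{: U}| ->
  exists u, forall x : U, x ^+ (p ^ u) = 1.
Proof.
by move=> /p_natP[u cU]; exists u => x; rewrite -cU -cardsT expg_cardG ?inE.
Qed.

(** Conjugating a base function by the top element [g^-1] reads it at [h * g], so the recursion on
    [Y] says exactly that [[~ C i, B] = C i.+1]. *)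
Lemma engel_wreath (k : nat) (U W : finGroupType) (Y : W -> nat -> U) (g : W) :
  (forall h i, Y (h * g) i = Y h i * Y h i.+1) -> (forall h, Y h k.+1 = 1) ->
  exists psi : {multiplicative engelGroup k -> wreath U W},
    psi (engel_b k) = wreath_top U W g^-1 /\
    forall i, psi (engel_c k i) = ([ffun h => Y h i], 1).
Proof.
move=> Yg Yk; pose C i : wreath U W := ([ffun h => Y h i], 1).
pose B : wreath U W := wreath_top U W g^-1.
have CB i : [~ C i, B] = C i.+1.
  have C2 j : (C j).2 = 1 by [].
  have C1 j h : (C j).1 h = Y h j by rewrite ffunE.
  have B1 h : B.1 h = 1 by rewrite ffunE.
  have B2 : B.2 = g^-1 by [].
  apply: wreathP; rewrite commgEl conjgE; last first.
    by rewrite !(wreathM2, wreathV2) !C2 invg1 !mul1g mulVg.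
  move=> h; rewrite !(wreathM1, wreathV1, wreathM2, wreathV2).
  rewrite !(B1, C1, C2, B2) !gsimp Yg.
  by rewrite mulKg.
have Cn i : left_normed_comm (C 0) (nseq i B) = C i.
  by elim: i => [//|i IHi]; rewrite iter_comm_rec IHi CB.
have [|psi [psia psib]] := @engel_hom k _ (C 0) B.
  by rewrite Cn; apply: wreathP => // h; rewrite !ffunE.
by exists psi; split=> // i; rewrite hom_left_normed map_nseq psia psib Cn.
Qed.

Section EngelQuotients.
Variables (p : nat) (p_prime : prime p) (k : nat).
Local Notation a := (@engel_a k).
Local Notation b := (@engel_b k).
Local Notation iota := (@engel_iota k).

(** The shift of the tuple of values of [f] has period [p ^ e], which gives a map to the wreath
    product of [U] with Z/p^e. Coordinate 0 recovers [f], while powers of the image of [b] have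
    trivial base component. *)
Lemma engel_quotient (U : finGroupType) (f : {multiplicative freeGroup 'I_k.+1 -> U}) :
  p.-nat #|{: U}| ->
  exists (V : finGroupType) (psi : {multiplicative engelGroup k -> V}),
    p.-nat #|{: V}| /\ forall x, in_cycle (psi b) (psi (iota x)) -> f x = 1.
Proof.
move=> pU; have [u Up] := finite_p_exponent pU.
pose Y := shift_seq (fun i => f (free_gen i)).
have [e Ye] := shift_seq_period (fun i => f (free_gen i)) Up.
have p0 : (0 < p ^ e)%N by rewrite expn_gt0 prime_gt0.
pose P := (p ^ e).-1; have PE : P.+1 = (p ^ e)%N by rewrite prednK.
(* The product in ['I_P.+1] is addition mod [p ^ e]; the wrap-around at the last index is where the
   period enters. *)
have YP (h : 'I_P.+1) i : Y (h * inZp 1 : 'I_P.+1) i = Y h i * Y h i.+1.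
  have -> : val (h * inZp 1 : 'I_P.+1) = (h.+1 %% P.+1)%N.
    by rewrite /= modnDmr addn1.
  have [hP|hP] := ltnP h.+1 P.+1; first by rewrite modn_small.
  have hE : h.+1 = P.+1 by apply/anti_leq; rewrite hP ltn_ord.
  by rewrite hE modnn -[RHS]/(Y h.+1 i) hE PE -[LHS](Ye 0%N) addn0.
have [|psi [psib psic]] := @engel_wreath k U 'I_P.+1 _ _ YP.
  by move=> h; apply: shift_seq_out.
exists (wreath U 'I_P.+1), psi; split; first by rewrite wreath_pnat // card_ord PE pnatX pnat_id.
have psi_iota x : (psi (iota x)).2 = 1 /\ (psi (iota x)).1 ord0 = f x.
  have psig (i : 'I_k.+1) :
      psi (iota (free_gen i)) = ([ffun h : 'I_P.+1 => Y h i], 1).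
    by rewrite free_hom_gen psic.
  elim/free_ind: x => [|l x [IH2 IH1]]; first by rewrite !hom1 /= ffunE.
  rewrite !gmulfM wreathM2 wreathM1 IH2 word_class1 !hom_letter.
  case: l => i [] /=; rewrite /letter_val /= psig ?wreathV1 ?invg1 !mulg1 ffunE.
    by rewrite IH1 /Y shift_seq0.
  by rewrite IH1 /Y shift_seq0.
move=> x; rewrite psib => -[n [m e']].
have [_ <-] := psi_iota x; rewrite e' -!homX -homV -gmulfM.
by rewrite ffunE.
Qed.

Lemma engel_expsum e : exists chi : {multiplicative engelGroup k -> 'I_(p ^ e).-1.+1},
  chi a = 1 /\ chi b = inZp 1.
Proof.
apply: engel_hom; elim: k.+1 => [//|i IHi].
by rewrite iter_comm_rec IHi comm1g.
Qed.

Lemma engel_expsum_sep n m x : n <> m ->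
  exists (V : finGroupType) (chi : {multiplicative engelGroup k -> V}),
    [/\ p.-nat #|{: V}|, chi a = 1 & chi (iota x * (b ^+ n * b ^- m)) <> 1].
Proof.
(* [p ^ (n + m)] exceeds both [n] and [m], so these stay distinct modulo it. *)
move=> nm; pose e := (n + m)%N; have [chi [chia chib]] := engel_expsum e.
have p0 : (0 < p ^ e)%N by rewrite expn_gt0 prime_gt0.
exists 'I_(p ^ e).-1.+1, chi; split=> //.
  by rewrite card_ord prednK // pnatX pnat_id.
have -> : chi (iota x * (b ^+ n * b ^- m)) = inZp 1 ^+ n * inZp 1 ^- m.
  rewrite !gmulfM homV !homX chib; set i := chi _.
  suff -> : i = 1 by rewrite mul1g.
  have chic j : chi (engel_c k j) = 1.
    rewrite /engel_c hom_left_normed chia; elim: j => [//|j IHj] /=.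
    by rewrite comm1g.
  apply: (@free_hom_sub _ _ [set z | z = 1]%classic (comp_hom chi iota)).
    split=> //= [y z -> ->|y ->]; first exact: mulg1.
    exact: invg1.
  by move=> j; suff: chi (iota (free_gen j)) = 1 by []; rewrite free_hom_gen chic.
move=> /divg1_eq /(congr1 val); rewrite -[_ ^+ n]/(inZp 1 *+ n)%R.
rewrite -[_ ^+ m]/(inZp 1 *+ m)%R.
have lt_e : (e < p ^ e)%N by apply: ltn_expl; apply: prime_gt1.
have valX j : (j < p ^ e)%N -> val (inZp 1 *+ j : 'I_(p ^ e).-1.+1)%R = j.
  by move=> je; rewrite Zp_mulrn /= modnMml mul1n modn_small // prednK.
by rewrite !valX //; apply: leq_ltn_trans lt_e; rewrite ?leq_addr ?leq_addl.
Qed.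

Lemma engel_cycle_eq (z : engelGroup k) : in_cycle b z ->
  z = 1 \/ exists n m, n <> m /\ z = b ^+ n * b ^- m.
Proof.
move=> [n [m ->]]; have [->|/eqP nm] := eqVneq n m; first by left; rewrite mulgV.
by right; exists n, m.
Qed.

Lemma engel_residually_p (h : engelGroup k) : h <> 1 ->
  exists (V : finGroupType) (psi : {multiplicative engelGroup k -> V}),
    p.-nat #|{: V}| /\ psi h <> 1.
Proof.
have [f [z [bz ->]]] := engel_normal_form h.
have [->|[n [m [nm ->]]] _] := engel_cycle_eq bz; last first.
  by have [V [chi [pV _ chi1]]] := engel_expsum_sep f nm; exists V, chi.
rewrite mulg1 => f1; have {}f1 : f <> 1 by move=> e; rewrite e hom1 in f1.
have [U [g [pU gf]]] := free_residually_p p_prime f1.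
have [V [psi [pV psiP]]] := engel_quotient g pU; exists V, psi; split=> // e.
by apply/gf/psiP; rewrite e; apply: in_cycle1.
Qed.

(** A nonzero exponent of [b] is seen by [chi], which kills [a]. Otherwise [h] comes from a word [f]
    not commuting with the free generator over [a], and their commutator is kept alive. *)
Lemma engel_a_separable (h : engelGroup k) : ~ in_cycle a h ->
  exists (V : finGroupType) (psi : {multiplicative engelGroup k -> V}),
    p.-nat #|{: V}| /\ ~ in_cycle (psi a) (psi h).
Proof.
have [f [z [bz ->]]] := engel_normal_form h.
have [->|[n [m [nm ->]]] _] := engel_cycle_eq bz; last first.
  have [V [chi [pV chia chi1]]] := engel_expsum_sep f nm.
  exists V, chi; split=> //; rewrite chia => -[i [j]]; rewrite !expg1n invg1 mulg1.
  exact: chi1.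
rewrite mulg1 => fa; have f0 : ~ in_cycle (free_gen ord0) f.
  by move/(hom_in_cycle iota); rewrite engel_iota0.
have [|U [g [pU gf]]] := @free_residually_p _ p_prime _ [~ free_gen ord0, f].
  move/eqP/commgP/commute_sym/(free_centralizer (@free_gen_not_proper_power _ _)).
  exact: f0.
have [V [psi [pV psiP]]] := engel_quotient g pU; exists V, psi; split=> // fV.
apply/gf/psiP; rewrite !homR engel_iota0.
have /commgP/eqP -> := in_cycle_commute fV; exact: in_cycle1.
Qed.

Lemma engel_b_separable (h : engelGroup k) : ~ in_cycle b h ->
  exists (V : finGroupType) (psi : {multiplicative engelGroup k -> V}),
    p.-nat #|{: V}| /\ ~ in_cycle (psi b) (psi h).
Proof.
have [f [z [bz ->]]] := engel_normal_form h => fz.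
have f1 : f <> 1 by move=> e; apply: fz; rewrite e hom1 mul1g.
have [U [g [pU gf]]] := free_residually_p p_prime f1.
have [V [psi [pV psiP]]] := engel_quotient g pU; exists V, psi; split=> // fV.
apply/gf/psiP; have := in_cycleM fV (in_cycleV (hom_in_cycle psi bz)).
by rewrite gmulfM mulgK.
Qed.

Lemma engel_a_expg n : (0 < n)%N -> a ^+ n <> 1.
Proof.
move=> n0; have f1 : free_gen (ord0 : 'I_k.+1) ^+ n <> 1.
  exact: not_proper_power_expg_neq1 (@free_gen_not_proper_power _ _) n0.
have [U [g [pU gf]]] := free_residually_p p_prime f1.
have [V [psi [pV psiP]]] := engel_quotient g pU => e.
by apply/gf/psiP; rewrite homX engel_iota0 e hom1; apply: in_cycle1.
Qed.

Lemma engel_b_expg n : (0 < n)%N -> b ^+ n <> 1.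
Proof.
move=> n0 e; have [|V [chi [_ _]]] := @engel_expsum_sep n 0 1; first by lia.
by rewrite e !gsimp hom1 => /(_ (hom1 chi)).
Qed.
End EngelQuotients.

(** * Extending homomorphisms to wreath products with Z/p *)

Section InvariantHom.
Variables (p : nat) (p_prime : prime p) (G : groupType).
Implicit Types (K : G -> Prop) (lam : G -> 'F_p).

(** A homomorphism from a kernel [K] to Z/p, invariant under conjugation by all of [G]; the values
    of [lam] off [K] are immaterial. *)
Definition invariant_hom K lam : Prop :=
  (forall x y, K x -> K y -> lam (x * y) = (lam x + lam y)%R) /\
  (forall x g, K x -> lam (x ^ g) = lam x).

Lemma invariant_hom0 K : invariant_hom K (fun=> 0%R).
Proof. by split=> // x y _ _; rewrite GRing.addr0. Qed.

Lemma invariant_homX K lam x n : is_subgroup K -> invariant_hom K lam -> K x ->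
  lam (x ^+ n) = (n%:R * lam x)%R.
Proof.
move=> [K1 KM _] [lamM _] Kx.
have l1 : lam 1 = 0%R.
  by apply: (GRing.addrI (lam 1)); rewrite -lamM // mulg1 GRing.addr0.
have KX m : K (x ^+ m) by elim: m => [//|m IHm]; rewrite expgS; apply: KM.
elim: n => [|n IHn]; first by rewrite expg0 l1 GRing.mul0r.
by rewrite expgS lamM // IHn -GRing.nat1r GRing.mulrDl GRing.mul1r.
Qed.

Lemma invariant_homZ K lam (t : 'F_p) :
  invariant_hom K lam -> invariant_hom K (fun x => t * lam x)%R.
Proof.
move=> [lamM lamJ]; split=> [x y Kx Ky|x g Kx]; last by rewrite lamJ.
by rewrite lamM // GRing.mulrDr.
Qed.
End InvariantHom.

Section KaloujnineKrasner.
Variables (p : nat) (p_prime : prime p) (G : groupType) (W : finGroupType).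
Variables (rho : {multiplicative G -> W}) (lam : G -> 'F_p).
Hypothesis lamP : invariant_hom (fun x => rho x = 1) lam.

(** [rho] may fail to be onto, so one representative is fixed in each left coset of its image; the
    default 1 never occurs. *)
Let same_coset (h : W) : pred W := fun r => `[< exists x, h = r * rho x >].
Let coset_rep h := odflt 1 [pick r | same_coset h r].

Lemma kk_rep h : exists x, h = coset_rep h * rho x.
Proof.
rewrite /coset_rep; case: pickP => [r /asboolP //|/(_ h)/asboolP[]].
by exists 1; rewrite hom1 mulg1.
Qed.

Lemma kk_repM h g : coset_rep (h * rho g) = coset_rep h.
Proof.
congr odflt; apply: eq_pick => r; apply: asbool_equiv_eq; split=> -[x e].
  by exists (x * g^-1); rewrite gmulfM homV mulgA -e mulgK.
by exists (x * g); rewrite gmulfM mulgA -e.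
Qed.

Let sec h : G := projT1 (cid (kk_rep h)).

Lemma kk_sec h g : rho (sec h * g * (sec (h * rho g))^-1) = 1.
Proof.
have sE i : rho (sec i) = (coset_rep i)^-1 * i.
  by rewrite {3}(projT2 (cid (kk_rep i))) mulKg.
by rewrite !gmulfM homV !sE kk_repM !mulgA mulgV.
Qed.

Let kk_fun g : wreath 'F_p W :=
  ([ffun h => lam (sec h * g * (sec (h * rho g))^-1)], rho g).

Lemma kk_fun_subproof : {morph kk_fun : x y / x * y}.
Proof.
move=> x y; apply: wreathP; last by rewrite /= gmulfM.
move=> h; rewrite wreathM1 !ffunE /= -[RHS]lamP.1 ?kk_sec //.
by rewrite gmulfM !mulgA mulgVK.
Qed.

(* The Kaloujnine-Krasner embedding, pushed out along [lam]. *)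
Lemma kaloujnine_krasner :
  exists rho' : {multiplicative G -> wreath 'F_p W},
    [/\ forall g, (rho' g).2 = rho g,
        forall g, rho g = 1 -> rho' g = ([ffun=> lam g], 1) &
        forall g, rho' g = 1 <-> rho g = 1 /\ lam g = 0%R].
Proof.
have ker g : rho g = 1 -> kk_fun g = ([ffun=> lam g], 1).
  move=> g1; apply: wreathP => [h|]; last by [].
  rewrite !ffunE g1 mulg1 -[RHS](lamP.2 _ (sec h)^-1 g1).
  by rewrite conjgE invgK mulgA.
exists (mkhom kk_fun_subproof); split=> // g; split=> [g1|[g1 lg]].
  have {}g1 : kk_fun g = 1 by [].
  have rg : rho g = 1 by have := congr1 snd g1.
  split=> //; move: g1; rewrite ker // => /(congr1 (fun w : wreath _ _ => w.1 1)).
  by rewrite wreath11 ffunE.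
by rewrite -[LHS]/(kk_fun g) ker // lg.
Qed.
End KaloujnineKrasner.

Section Coboundary.
Variables (U W : finGroupType) (U_comm : forall a b : U, commute a b).
Implicit Types x y : wreath U W.

Lemma wreathX2 x n : (x ^+ n).2 = x.2 ^+ n.
Proof. by elim: n => [//|n IHn]; rewrite !expgS wreathM2 IHn. Qed.

(* Elements of [U wr W] with the same image in [W] and equal powers in the base are
   conjugate under the base: their difference sums to zero along every cycle. *)
Lemma wreath_coboundary x y : x.2 = y.2 ->
  (forall m, x.2 ^+ m = 1 -> x ^+ m = y ^+ m) ->
  exists s : wreath U W, x ^ s = y.
Proof.
move=> xy2 xyX; set c := x.2 in xy2 xyX.
pose same_orbit h : pred W := fun r => `[< exists i, h = r * c ^+ i >].
pose orb h := odflt 1 [pick r | same_orbit h r].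
have orbP h : exists i, h = orb h * c ^+ i.
  rewrite /orb; case: pickP => [r /asboolP //|/(_ h)/asboolP[]].
  by exists 0%N; rewrite mulg1.
have orbM h : orb (h * c) = orb h.
  congr odflt; apply: eq_pick => r; apply: asbool_equiv_eq; split=> -[i e].
    exists (i + #[c].-1)%N; rewrite expgnDr mulgA -e -mulgA -expgS.
    by rewrite prednK ?order_gt0 // expg_order mulg1.
  by exists i.+1; rewrite expgSr mulgA -e.
pose idx h := projT1 (cid (orbP h)).
have idxP h : h = orb h * c ^+ idx h by exact: projT2 (cid (orbP h)).
have mulVC (a b a' b' : U) : (a * b)^-1 * (a' * b') = (a^-1 * a') * (b^-1 * b').
  by rewrite invgM -mulgA (mulgA a^-1) mulgA (U_comm b^-1) mulgA.
(* The conjugator must satisfy [s (h * c) = s h * (x.1 h)^-1 * y.1 h]. [E i r] solves this along the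
   orbit of [r], and equality of the powers in the base makes it depend only on [c ^+ i]. *)
pose E i r : U := ((x ^+ i).1 r)^-1 * (y ^+ i).1 r.
have ES i r : E i.+1 r = E i r * ((x.1 (r * c ^+ i))^-1 * y.1 (r * c ^+ i)).
  by rewrite /E !expgSr !wreathM1 !wreathX2 -xy2 -/c mulVC.
have Em i m r : c ^+ m = 1 -> E (i + m)%N r = E i r.
  by move=> cm; rewrite /E !expgnDr !wreathM1 !wreathX2 -xy2 -/c (xyX _ cm) mulVC mulVg mulg1.
have Emod i j r : c ^+ i = c ^+ j -> E i r = E j r.
  wlog: i j / (i <= j)%N => [H|/subnKC <-] e.
    by have [ij|/ltnW ji] := leqP i j; [apply: H|apply/esym/H].
  rewrite Em //; apply: (mulgI (c ^+ i)).
  by move: e; rewrite expgnDr mulg1.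
exists (wreath_base (fun h => E (idx h) (orb h))).
apply: wreathP => [h|].
  rewrite conjgE !(wreathM1, wreathV1, wreathM2, wreathV2) /= !ffunE.
  rewrite !gsimp -/c.
  have -> : E (idx (h * c)) (orb (h * c)) = E (idx h).+1 (orb h).
    rewrite orbM; apply: Emod; apply: (mulgI (orb h)).
    by rewrite -{1}(orbM h) -idxP expgSr mulgA -idxP.
  rewrite ES -idxP; set e := E _ _; set a := x.1 h.
  by rewrite (mulgA a) (U_comm a) -(mulgA e) mulKg mulVKg.
by rewrite conjgE !(wreathM2, wreathV2) /= !gsimp.
Qed.
End Coboundary.

(** * Descent along central series of finite p-groups *)

Section CentralQuotient.
Variables (p : nat) (p_prime : prime p).

(** The quotient is by a central subgroup of order [p] generated by some [z], and [dl] reads the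
    exponent of [z] mod [p]. *)
Lemma central_quotient (P : finGroupType) : p.-nat #|{: P}| -> (1 < #|{: P}|)%N ->
  exists (Q : finGroupType) (f : {multiplicative P -> Q}) (dl : P -> 'F_p),
    [/\ p.-nat #|{: Q}|, (#|{: Q}| < #|{: P}|)%N,
        invariant_hom (fun x => f x = 1) dl &
        forall x, f x = 1 -> (dl x = 0%R <-> x = 1)].
Proof.
move=> pP P1; have pgP : p.-group [set: P] by rewrite /pgroup cardsT.
have ZP1 : 'Z([set: P]) != 1.
  apply: contraTneq P1 => /(trivg_center_pgroup pgP) /eqP.
  by rewrite trivg_card1 cardsT => /eqP ->.
have pgZ : p.-group 'Z([set: P]) by apply: pgroupS pgP; apply: center_sub.
have [_ pZ _] := pgroup_pdiv pgZ ZP1.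
have [z Zz oz] := Cauchy p_prime pZ.
have cz x : commute z x by have [_ H] := centerP _ _ Zz; apply: H; rewrite inE.
pose C := <[z]>%G.
have NC x : x \in 'N(C).
  by apply: (fintype.subsetP (cent_sub C)); rewrite cent_cycle; apply/cent1P/commute_sym.
have fM : {morph coset C : x y / x * y} by move=> x y; rewrite morphM.
have kerC x : coset C x = 1 -> exists n, x = z ^+ n.
  by move/(coset_idr (NC x)) => /cycleP.
have cC x g : coset C x = 1 -> x ^ g = x.
  move=> /kerC[n ->]; apply/conjg_fixP/commgP/commute_sym/commuteX.
  exact/commute_sym/cz.
have cardQ : (#|{: coset_of C}| * p = #|{: P}|)%N.
  rewrite -[#|{: P}|]cardsT -oz -(Lagrange (finset.subsetT C)) mulnC; congr (_ * _)%N.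
  rewrite -card_quotient; last by apply/fintype.subsetP => x _; apply: NC.
  rewrite -cardsT; apply: eq_card => x; rewrite inE -[x]coset_reprK.
  by rewrite mem_quotient ?inE.
pose dl x : 'F_p := if pselect (exists n, x = z ^+ n) is left e then (projT1 (cid e))%:R%R else 0%R.
have dlE n : dl (z ^+ n) = n%:R%R.
  rewrite /dl; case: pselect => [e|[]]; last by exists n.
  case: (cid e) => m /= /eqP; rewrite eq_expg_mod_order oz => /eqP nm.
  by rewrite -Fp_nat_mod // -nm Fp_nat_mod.
have p0 := prime_gt0 p_prime.
exists (coset_of C), (mkhom fM), dl; split.
- by apply: (@pnat_dvd _ #|{: P}|) => //; rewrite -cardQ dvdn_mulr.
- rewrite -cardQ -[X in (X < _)%N]muln1 ltn_pmul2l ?prime_gt1 //.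
  by apply/card_gt0P; exists 1.
- split=> [x y /kerC[n ->] /kerC[m ->]|x g /cC -> //].
  by rewrite -expgnDr !dlE GRing.natrD.
move=> x /kerC[n ->]; rewrite dlE; split=> [/eqP|/eqP].
  by rewrite -(GRing.dvdn_pcharf (pchar_Fp p_prime)) -oz order_dvdn => /eqP.
by rewrite -order_dvdn oz (GRing.dvdn_pcharf (pchar_Fp p_prime)) => /eqP.
Qed.
End CentralQuotient.

Section Descent.
Variables (p : nat) (p_prime : prime p) (G : groupType).
Variables (R : (G -> Prop) -> Prop) (T : G -> Prop).
Hypothesis R_cut : forall K lam, R K -> @invariant_hom p G K lam ->
  (forall x, T x -> K x -> lam x = 0%R) ->
  exists2 K', R K' & forall x, K' x -> K x /\ lam x = 0%R.

(** Induction on the order of [P]: below the kernel of [phi] modulo a central subgroup of order [p],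
    [phi] is an invariant homomorphism to Z/p, and [R] allows the cut by it. *)
Lemma descend_below (P : finGroupType) (phi : {multiplicative G -> P}) K :
  p.-nat #|{: P}| -> (forall x, T x -> phi x = 1) -> R K ->
  exists2 K', R K' & forall x, K' x -> K x /\ phi x = 1.
Proof.
have [n] := ubnP #|{: P}|; elim: n P phi K => // n IHn P phi K /ltnSE-leP pP phiT RK.
have [P1|/card_le1_eqP P1] := ltnP 1 #|{: P}|; last first.
  by exists K => // x Kx; split=> //; apply: P1.
have [Q [f [dl [pQ ltQ dlP dl0]]]] := central_quotient p_prime pP P1.
have [|x Tx|K1 RK1 K1K] := IHn Q (comp_hom f phi) K _ pQ _ RK.
- exact: leq_trans ltQ leP.
- by rewrite /= phiT // hom1.
have K1f x : K1 x -> f (phi x) = 1 by move=> /K1K[].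
have [||K2 RK2 K2K] := R_cut RK1 (lam := dl \o phi).
- by split=> [x y /K1f fx /K1f fy|x g /K1f fx] /=; [rewrite gmulfM|rewrite homJ]; apply dlP.
- by move=> x Tx _ /=; rewrite phiT // dl0 ?hom1.
exists K2 => // x /K2K[K1x /=]; split; first by have [] := K1K _ K1x.
by apply/dl0 => //; apply: K1f.
Qed.
End Descent.

(** The descent stops at the first central layer in which [phi c] is nontrivial; there [dl (phi c)]
    is nonzero and can be rescaled to [t]. All earlier cuts vanish on [c]. *)
Lemma descend_to_jump (p : nat) (p_prime : prime p) (G : groupType)
    (R : (G -> Prop) -> Prop) (c : G) :
  (forall K lam, R K -> @invariant_hom p G K lam -> lam c = 0%R ->
    exists2 K', R K' & forall x, K' x -> K x /\ lam x = 0%R) ->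
  (forall K, R K -> K c) ->
  forall (P : finGroupType) (phi : {multiplicative G -> P}) K,
  p.-nat #|{: P}| -> phi c <> 1 -> R K -> forall t : 'F_p,
  exists K' lam, [/\ R K', forall x, K' x -> K x,
    @invariant_hom p G K' lam & lam c = t].
Proof.
move=> R_cut Rc P phi K; have [n] := ubnP #|{: P}|.
elim: n P phi K => // n IHn P phi K /ltnSE-leP pP phic RK t.
have [P1|/card_le1_eqP P1] := ltnP 1 #|{: P}|; last by case: phic; apply: P1.
have [Q [f [dl [pQ ltQ dlP dl0]]]] := central_quotient p_prime pP P1.
have [fc|fc] := pselect (f (phi c) = 1); last first.
  exact: (IHn Q (comp_hom f phi) K (leq_trans ltQ leP) pQ fc RK).
have [|x <- //|K1 RK1 K1K] := @descend_below p p_prime G R (eq c) _ Q (comp_hom f phi) K pQ _ RK.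
  by move=> K0 lam RK0 lamP lamc; apply: (R_cut K0 lam) => //; apply: lamc => //; apply: Rc.
have K1f x : K1 x -> f (phi x) = 1 by move=> /K1K[].
exists K1, (fun x => t / dl (phi c) * dl (phi x))%R; split=> //.
- by move=> x /K1K[].
- apply: (@invariant_homZ _ _ _ (dl \o phi)).
  by split=> [x y /K1f fx /K1f fy|x g /K1f fx] /=; [rewrite gmulfM|rewrite homJ]; apply dlP.
by rewrite GRing.divfK //; apply/eqP => /(dl0 _ fc).
Qed.

(** * Compatible finite p-quotients of a star of groups *)

Lemma hom_kernel_subgroup (G H : groupType) (f : {multiplicative G -> H}) :
  is_subgroup (fun x => f x = 1).
Proof.
split=> [|x y fx fy|x fx]; first exact: hom1.
  by rewrite gmulfM fx fy mulg1.
by rewrite homV fx invg1.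
Qed.

Section Star.
Variables (p : nat) (p_prime : prime p) (A H : groupType).
Variables (u : bool -> A) (h : bool -> H).
Implicit Types (K : bool -> A -> Prop) (L : H -> Prop).

Record star_state := StarState {
  star_group :> finGroupType;
  star_pgroup : p.-nat #|{: star_group}|;
  star_leaf : bool -> {multiplicative A -> star_group};
  star_center : {multiplicative H -> star_group};
  star_compat : forall i, star_leaf i (u i) = star_center (h i) }.

Definition reachable K L : Prop := exists S : star_state,
  (forall i x, K i x <-> star_leaf S i x = 1) /\ (forall x, L x <-> star_center S x = 1).

Lemma reachable_ext K K' L L' : (forall i x, K i x <-> K' i x) ->
  (forall x, L x <-> L' x) -> reachable K L -> reachable K' L'.
Proof.
move=> KK LL [S [SK SL]]; exists S; split=> [i x|x].
  by rewrite -SK KK.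
by rewrite -SL LL.
Qed.

Lemma reachable_subgroup K L : reachable K L ->
  (forall i, is_subgroup (K i)) /\ is_subgroup L.
Proof.
move=> [S [SK SL]]; split=> [i|].
  have -> : K i = (fun x => star_leaf S i x = 1) by apply/funext => x; apply/propext.
  exact: hom_kernel_subgroup.
have -> : L = (fun x => star_center S x = 1) by apply/funext => x; apply/propext.
exact: hom_kernel_subgroup.
Qed.

Lemma reachable_order K L : reachable K L -> exists q : bool -> nat,
  [/\ forall i, (0 < q i)%N, forall i n, K i (u i ^+ n) <-> (q i %| n)%N &
      forall i n, L (h i ^+ n) <-> (q i %| n)%N].
Proof.
move=> [S [SK SL]]; exists (fun i => #[star_center S (h i)]).
split=> [i|i n|i n]; first exact: order_gt0.
  by rewrite SK homX star_compat order_dvdn; split=> /eqP.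
by rewrite SL homX order_dvdn; split=> /eqP.
Qed.

(** All maps are extended to ['F_p] wr [S] by [kaloujnine_krasner]. The hypothesis on powers is what
    [wreath_coboundary] needs to conjugate each leaf so that [u i] and [h i] again have one
    image. *)
Lemma reachable_cut K L (lam : bool -> A -> 'F_p) (mu : H -> 'F_p) :
  reachable K L -> (forall i, invariant_hom (K i) (lam i)) -> invariant_hom L mu ->
  (forall i n, K i (u i ^+ n) -> lam i (u i ^+ n) = mu (h i ^+ n)) ->
  reachable (fun i x => K i x /\ lam i x = 0%R) (fun x => L x /\ mu x = 0%R).
Proof.
move=> [S [SK SL]] lamP muP lam_mu.
have KE i : K i = (fun x => star_leaf S i x = 1) by apply/funext => x; apply/propext.
have LE : L = (fun x => star_center S x = 1) by apply/funext => x; apply/propext.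
rewrite LE in muP *.
have FpC (a b : 'F_p) : commute a b by exact: GRing.addrC.
have [eta' [eta2 eta1 etaK]] := kaloujnine_krasner muP.
have /choice[alpha alphaP] i : exists rho' : {multiplicative A -> wreath 'F_p S},
    rho' (u i) = eta' (h i) /\
    forall x, rho' x = 1 <-> star_leaf S i x = 1 /\ lam i x = 0%R.
  have := lamP i; rewrite KE => /kaloujnine_krasner[rho [rho2 rho1 rhoK]].
  have [||s sP] := @wreath_coboundary 'F_p S FpC (rho (u i)) (eta' (h i)).
  - by rewrite rho2 eta2 star_compat.
  - move=> m; rewrite rho2 -homX => um; rewrite -!homX rho1 // eta1; last first.
      by rewrite homX -star_compat -homX.
    by rewrite lam_mu // KE.
  exists (comp_hom (conj_hom s) rho); split=> // x; rewrite -rhoK.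
  split=> [/eqP|e]; last by rewrite -[LHS]/(rho x ^ s) e conj1g.
  by rewrite -[_ == _]/(rho x ^ s == 1) conjg_eq1 => /eqP.
have pW : p.-nat #|{: wreath 'F_p S}|.
  by rewrite wreath_pnat ?star_pgroup // card_Fp // pnat_id.
have alphaE i : alpha i (u i) = eta' (h i) by have [] := alphaP i.
exists (StarState pW alphaE); split=> [i x|x] /=; last by rewrite etaK.
by rewrite KE; have [_ ->] := alphaP i.
Qed.

Hypothesis A_res : forall x : A, x <> 1 ->
  exists (P : finGroupType) (f : {multiplicative A -> P}), p.-nat #|{: P}| /\ f x <> 1.
Hypothesis H_res : forall x : H, x <> 1 ->
  exists (P : finGroupType) (f : {multiplicative H -> P}), p.-nat #|{: P}| /\ f x <> 1.
Hypothesis u_inf : forall i n, (0 < n)%N -> u i ^+ n <> 1.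
Hypothesis h_inf : forall i n, (0 < n)%N -> h i ^+ n <> 1.

Lemma invariant_hom_dvd (G : groupType) (K : G -> Prop) lam (c : G) q n :
  is_subgroup K -> @invariant_hom p G K lam -> K (c ^+ q) -> (q %| n)%N ->
  lam (c ^+ n) = ((n %/ q)%:R * lam (c ^+ q)%g)%R.
Proof.
move=> sK lamP Kc /divnK {1}<-; rewrite mulnC expgnA.
exact: invariant_homX lamP Kc.
Qed.

Definition set_leaf K j Kj : bool -> A -> Prop := fun i => if i == j then Kj else K i.

(** Cuts of leaf [j] vanishing on [u j ^+ q] leave the center unchanged, so they can be iterated
    until a homomorphism with the prescribed value on [u j ^+ q] appears. *)
Lemma prepare_leaf K L q j (t : 'F_p) : reachable K L -> (0 < q)%N ->
  (forall n, L (h j ^+ n) <-> (q %| n)%N) ->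
  exists K' lam, [/\ reachable K' L, forall i x, K' i x -> K i x,
    forall i x, i != j -> (K' i x <-> K i x), invariant_hom (K' j) lam &
    lam (u j ^+ q) = t].
Proof.
move=> RKL q0 Lq.
pose R Kj := reachable (set_leaf K j Kj) L /\ forall x, Kj x -> K j x.
have set_j Kj : set_leaf K j Kj j = Kj by rewrite /set_leaf eqxx.
have Rq Kj n : R Kj -> Kj (u j ^+ n) <-> (q %| n)%N.
  move=> [[S [SK SL]] _]; rewrite -Lq SL homX -star_compat -homX.
  by rewrite -[Kj in X in X <-> _]set_j SK.
have [P [phi [pP phiu]]] := A_res (u_inf q0 : u j ^+ q <> 1).
have RKj : R (K j).
  split=> //; apply: reachable_ext RKL => // i x; rewrite /set_leaf.
  by case: eqP => [->|].
have cut Kj (lam : A -> 'F_p) : R Kj -> invariant_hom Kj lam -> lam (u j ^+ q) = 0%R ->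
    exists2 K', R K' & forall x, K' x -> Kj x /\ lam x = 0%R.
  move=> RKj' lamP lamu; exists (fun x => Kj x /\ lam x = 0%R) => //.
  split; last by move=> x [Kx _]; apply: RKj'.2.
  have [sK _] := reachable_subgroup RKj'.1.
  have lamP' i : invariant_hom (set_leaf K j Kj i) (if i == j then lam else fun=> 0%R).
    by rewrite /set_leaf; case: ifP => _ //; apply: invariant_hom0.
  have := reachable_cut RKj'.1 lamP' (@invariant_hom0 p _ L).
  case=> [i n|S [SK SL]].
    rewrite /set_leaf; case: eqP => [-> Kn|//].
    have qn : (q %| n)%N by apply/(Rq Kj).
    rewrite (invariant_hom_dvd _ lamP _ qn) ?lamu ?GRing.mulr0 //; last exact/(Rq Kj).
    by have := sK j; rewrite set_j.
  exists S; split=> [i x|x]; last by rewrite -SL; split=> [|[]].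
  by rewrite -SK /set_leaf; case: ifP => _ //; split=> [|[]].
have [|K' [lam [RK' K'K lamP lamt]]] :=
    descend_to_jump p_prime cut _ pP phiu RKj t.
  by move=> Kj RKj'; apply/(Rq _ _ RKj').
exists (set_leaf K j K'), lam; split=> // [|i x|i x|].
- exact: RK'.1.
- by rewrite /set_leaf; case: eqP => [-> /K'K|].
- by rewrite /set_leaf => /negPf ->.
by rewrite set_j.
Qed.

Lemma prepare_leaves (J : pred bool) K L q (t : bool -> 'F_p) : reachable K L ->
  (forall i, 0 < q i)%N -> (forall i n, L (h i ^+ n) <-> (q i %| n)%N) ->
  exists K' lam, [/\ reachable K' L, forall i x, K' i x -> K i x,
    forall i x, J i -> (K' i x <-> K i x),
    forall i, ~~ J i -> invariant_hom (K' i) (lam i) &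
    forall i, ~~ J i -> lam i (u i ^+ q i) = t i].
Proof.
move=> RKL q0 Lq.
have step K0 j : reachable K0 L -> exists K' lam, [/\ reachable K' L,
    forall i x, K' i x -> K0 i x, forall i x, (i != j) || J i -> (K' i x <-> K0 i x),
    ~~ J j -> invariant_hom (K' j) lam & ~~ J j -> lam (u j ^+ q j) = t j].
  move=> RK0; case Jj: (J j).
    by exists K0, (fun=> 0%R).
  have [K' [lam [RK' K'K0 K'i lamP lamt]]] := prepare_leaf (t j) RK0 (q0 j) (Lq j).
  exists K', lam; split=> // i x.
  by have [->|ij _] := eqVneq i j; [rewrite Jj|apply: K'i].
have [K1 [lam1 [R1 K1K K1i lam1P lam1t]]] := step K true RKL.
have [K2 [lam2 [R2 K2K K2i lam2P lam2t]]] := step K1 false R1.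
exists K2, (fun i => if i then lam1 else lam2); split=> //.
- by move=> i x /K2K/K1K.
- by move=> i x Ji; rewrite K2i ?Ji ?orbT // K1i // Ji orbT.
- case=> // /lam1P; suff -> : K2 true = K1 true by [].
  by apply/funext => x; apply/propext; apply: K2i.
by case.
Qed.

(** Leaves outside [J] are first shrunk until they carry homomorphisms matching [mu]; leaves in [J]
    take the zero homomorphism and keep their kernels. *)
Lemma reachable_cut_center (J : pred bool) K L (mu : H -> 'F_p) : reachable K L ->
  invariant_hom L mu -> (forall i n, J i -> K i (u i ^+ n) -> mu (h i ^+ n) = 0%R) ->
  exists2 K', reachable K' (fun x => L x /\ mu x = 0%R) &
    (forall i x, K' i x -> K i x) /\ (forall i x, J i -> (K' i x <-> K i x)).
Proof.
move=> RKL muP muJ; have [q [q0 Kq Lq]] := reachable_order RKL.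
have [sK sL] := reachable_subgroup RKL.
have [K' [lam [RK' K'K K'J lamP lamt]]] :=
  prepare_leaves J (fun i => mu (h i ^+ q i)) RKL q0 Lq.
have [sK' _] := reachable_subgroup RK'.
pose lam' i := if J i then fun=> 0%R else lam i.
exists (fun i x => K' i x /\ lam' i x = 0%R); last first.
  split=> [i x [/K'K]//|i x Ji].
  by rewrite /lam' Ji K'J //; split=> [[]|].
apply: reachable_cut => // [i|i n].
  by rewrite /lam'; case: ifP => [_|/negbT/lamP//]; apply: invariant_hom0.
rewrite /lam'; case: ifP => [Ji|/negbT nJi] Kn; first by rewrite (muJ i) //; apply: K'K.
have qn : (q i %| n)%N by apply/(Kq i)/K'K.
have Lqq : L (h i ^+ q i) by apply/Lq.
have [S [SK SL]] := RK'; have Kqq : K' i (u i ^+ q i).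
  by rewrite SK homX star_compat -homX -SL.
rewrite (invariant_hom_dvd (sK' i) (lamP i nJi) Kqq qn).
by rewrite (invariant_hom_dvd sL muP Lqq qn) lamt.
Qed.

Lemma prepare_center K L q i (t : 'F_p) : reachable K L -> (0 < q)%N ->
  (forall n, K i (u i ^+ n) <-> (q %| n)%N) ->
  exists K' L' mu, [/\ reachable K' L', forall j x, K' j x -> K j x,
    forall x, L' x -> L x, forall x, K' i x <-> K i x &
    invariant_hom L' mu /\ mu (h i ^+ q) = t].
Proof.
move=> RKL q0 Kq.
pose R L' := exists K', [/\ reachable K' L', forall j x, K' j x -> K j x,
  forall x, L' x -> L x & forall x, K' i x <-> K i x].
have Rq L' n : R L' -> L' (h i ^+ n) <-> (q %| n)%N.
  move=> [K' [[S [SK SL]] _ _ K'i]].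
  by rewrite -Kq -K'i SK homX star_compat -homX SL.
have [P [phi [pP phih]]] := H_res (h_inf q0 : h i ^+ q <> 1).
have RL : R L by exists K.
have cut L' (mu : H -> 'F_p) : R L' -> invariant_hom L' mu -> mu (h i ^+ q) = 0%R ->
    exists2 L2, R L2 & forall x, L2 x -> L' x /\ mu x = 0%R.
  move=> RL' muP muh; exists (fun x => L' x /\ mu x = 0%R) => //.
  have [K' [RK' K'K L'L K'i]] := RL'; have [sK sL] := reachable_subgroup RK'.
  have [|K2 RK2 [K2K K2i]] := @reachable_cut_center (pred1 i) _ _ _ RK' muP.
    move=> j n /eqP -> Kn; have qn : (q %| n)%N by apply/Kq/K'i.
    rewrite (invariant_hom_dvd sL muP _ qn) ?muh ?GRing.mulr0 //.
    exact/(Rq L').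
  exists K2; split=> // [j x /K2K/K'K//|x [/L'L]//|x].
  by rewrite K2i /= ?eqxx.
have [|L2 [mu [[K2 [RK2 K2K L2L K2i]] _ muP mut]]] :=
    descend_to_jump p_prime cut _ pP phih RL t.
  by move=> L' RL'; apply/(Rq _ _ RL').
by exists K2, L2, mu.
Qed.

Lemma refine_center K L (P : finGroupType) (phi : {multiplicative H -> P}) :
  p.-nat #|{: P}| -> reachable K L ->
  exists K' L', [/\ reachable K' L', forall j x, K' j x -> K j x,
    forall x, L' x -> L x & forall x, L' x -> phi x = 1].
Proof.
move=> pP RKL.
pose R L' := exists K', [/\ reachable K' L', forall j x, K' j x -> K j x &
  forall x, L' x -> L x].
have [|||L2 [K2 [RK2 K2K L2L]] L2P] := @descend_below p p_prime H R (fun=> False) _ P phi L pP.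
- move=> L' mu [K' [RK' K'K L'L]] muP _; exists (fun x => L' x /\ mu x = 0%R) => //.
  have [//|K2 RK2 [K2K _]] := @reachable_cut_center pred0 _ _ _ RK' muP.
  by exists K2; split=> // [j x /K2K/K'K//|x [/L'L]].
- by [].
- by exists K.
by exists K2, L2; split=> // x /L2P[].
Qed.

(** To cut leaf [i] by [lam], the center is prepared to carry a [mu] matching [lam], then the other
    leaf to match [mu], both without changing leaf [i]. *)
Lemma refine_leaf i K L (P : finGroupType) (phi : {multiplicative A -> P}) :
  p.-nat #|{: P}| -> reachable K L ->
  exists K' L', [/\ reachable K' L', forall j x, K' j x -> K j x,
    forall x, L' x -> L x & forall x, K' i x -> phi x = 1].
Proof.
move=> pP RKL.
pose R Ki := exists K' L', [/\ reachable K' L', forall j x, K' j x -> K j x,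
  forall x, L' x -> L x & forall x, Ki x <-> K' i x].
have [|||Ki [K2 [L2 [RK2 K2K L2L KiE]]] KiP] :=
    @descend_below p p_prime A R (fun=> False) _ P phi (K i) pP.
- move=> Ki lam [K' [L' [RK' K'K L'L KiE]]] lamP _.
  have {}KiE : Ki = K' i by apply/funext => x; apply/propext.
  rewrite {}KiE in lamP *.
  exists (fun x => K' i x /\ lam x = 0%R) => //.
  have [q [q0 Kq Lq]] := reachable_order RK'.
  have [K1 [L1 [mu [RK1 K1K L1L K1i [muP mut]]]]] :=
    prepare_center (lam (u i ^+ q i)) RK' (q0 i) (Kq i).
  have [q1 [q10 K1q L1q]] := reachable_order RK1.
  have [K3 [lam3 [RK3 K3K K3i lam3P lam3t]]] :=
    prepare_leaves (pred1 i) (fun j => mu (h j ^+ q1 j)) RK1 q10 L1q.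
  have [sK3 sL] := reachable_subgroup RK3.
  have [sK' _] := reachable_subgroup RK'.
  pose lam' j := if j == i then lam else lam3 j.
  have K3E : K3 i = K' i.
    by apply/funext => x; apply/propext; rewrite K3i /= ?eqxx // K1i.
  exists (fun j x => K3 j x /\ lam' j x = 0%R), (fun x => L1 x /\ mu x = 0%R).
  split=> [|j x [/K3K/K1K/K'K]//|x [/L1L/L'L]//|x]; last by rewrite /lam' eqxx K3E.
  apply: reachable_cut => // [j|j n].
    rewrite /lam'; case: eqP => [->|/eqP ji]; first by rewrite K3E.
    exact: lam3P.
  have [S [SK SL]] := RK3.
  have uh m j0 : K3 j0 (u j0 ^+ m) <-> L1 (h j0 ^+ m).
    by rewrite SK homX star_compat -homX SL.
  rewrite /lam'; case: eqP => [-> Kn|/eqP ji Kn].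
    have qn : (q i %| n)%N by apply/Kq; rewrite -K3E.
    have Kqq : K' i (u i ^+ q i) by apply/Kq.
    have Lqq : L1 (h i ^+ q i) by apply/uh; rewrite K3E.
    by rewrite (invariant_hom_dvd (sK' i) lamP Kqq qn) (invariant_hom_dvd sL muP Lqq qn) mut.
  have qn : (q1 j %| n)%N by apply/L1q/uh.
  have Lqq : L1 (h j ^+ q1 j) by apply/L1q.
  have Kqq : K3 j (u j ^+ q1 j) by apply/uh.
  by rewrite (invariant_hom_dvd (sK3 j) (lam3P j ji) Kqq qn) (invariant_hom_dvd sL muP Lqq qn) lam3t.
- by [].
- by exists K, L.
by exists K2, L2; split=> // x /KiE/KiP[].
Qed.

Hypothesis u_sep : forall i x, ~ in_cycle (u i) x -> exists (P : finGroupType)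
  (f : {multiplicative A -> P}), p.-nat #|{: P}| /\ ~ in_cycle (f (u i)) (f x).
Hypothesis h_sep : forall i x, ~ in_cycle (h i) x -> exists (P : finGroupType)
  (f : {multiplicative H -> P}), p.-nat #|{: P}| /\ ~ in_cycle (f (h i)) (f x).

(** Separation stated through the kernel alone, so that it visibly persists when [N] shrinks under
    later refinements. *)
Let off_cycle (G : groupType) (c : G) (N : G -> Prop) x :=
  forall n m, ~ N (x^-1 * (c ^+ n * c ^- m)).

Lemma off_cycle_hom (G Q : groupType) (f : {multiplicative G -> Q}) (N : G -> Prop) c x :
  (forall y, N y -> f y = 1) -> ~ in_cycle (f c) (f x) -> off_cycle c N x.
Proof.
move=> Nf fx n m /Nf; rewrite !gmulfM !homV !homX => /mulg1_eq.
by rewrite invgK => e; apply: fx; exists n, m.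
Qed.

Lemma hom_off_cycle (G Q : groupType) (f : {multiplicative G -> Q}) c x :
  off_cycle c (fun y => f y = 1) x -> ~ in_cycle (f c) (f x).
Proof.
move=> off [n [m e]]; apply: (off n m).
by rewrite !gmulfM !homV !homX e mulVg.
Qed.

Lemma star_separation (ys : seq (bool * A)) (xs : seq (bool * H)) (x0 : H) :
  {in ys, forall y, ~ in_cycle (u y.1) y.2} ->
  {in xs, forall x, ~ in_cycle (h x.1) x.2} ->
  exists S : star_state,
  [/\ {in ys, forall y, ~ in_cycle (star_leaf S y.1 (u y.1)) (star_leaf S y.1 y.2)},
      {in xs, forall x, ~ in_cycle (star_center S (h x.1)) (star_center S x.2)} &
      x0 <> 1 -> star_center S x0 <> 1].
Proof.
move=> ysP xsP.
have R0 : reachable (fun _ _ => True) (fun=> True).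
  have pI : p.-nat #|{: 'I_1}| by rewrite card_ord.
  have c1 (G : groupType) : {morph (fun _ : G => 1 : 'I_1) : x y / x * y} by move=> *; rewrite mulg1.
  exists (@StarState _ pI (fun=> mkhom (c1 A)) (mkhom (c1 H)) (fun=> erefl)).
  by split.
have [K0 [L0 [RK0 K0x]]] : exists K L, reachable K L /\ (x0 <> 1 -> ~ L x0).
  have [x01|/H_res[P [f [pP fx]]]] := pselect (x0 = 1).
    by exists (fun _ _ => True), (fun=> True).
  have [K [L [RK _ _ LP]]] := refine_center f pP R0.
  by exists K, L; split=> // _ /LP.
have [K1 [L1 [RK1 L10 L1x]]] : exists K L, [/\ reachable K L,
    forall x, L x -> L0 x & {in xs, forall x, off_cycle (h x.1) L x.2}].
  elim: xs xsP => [_|x xs IHxs xsP]; first by exists K0, L0; split=> // x.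
  have [|K [L [RK LL0 LP]]] := IHxs.
    by move=> y yxs; apply: xsP; rewrite inE yxs orbT.
  have [P [f [pP fx]]] := h_sep (xsP x (mem_head _ _)).
  have [K2 [L2 [RK2 _ L2L L2P]]] := refine_center f pP RK.
  exists K2, L2; split=> // [y /L2L/LL0//|y].
  rewrite inE => /predU1P[->|/LP yP n m /L2L/yP//].
  exact: off_cycle_hom L2P fx.
have [K2 [L2 [RK2 L21 K2y]]] : exists K L, [/\ reachable K L,
    forall x, L x -> L1 x & {in ys, forall y, off_cycle (u y.1) (K y.1) y.2}].
  elim: ys ysP => [_|y ys IHys ysP]; first by exists K1, L1; split=> // x.
  have [|K [L [RK LL0 KP]]] := IHys.
    by move=> x xys; apply: ysP; rewrite inE xys orbT.
  have [P [f [pP fy]]] := u_sep (ysP y (mem_head _ _)).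
  have [K3 [L3 [RK3 K3K L3L K3P]]] := refine_leaf y.1 f pP RK.
  exists K3, L3; split=> // [x /L3L/LL0//|x].
  rewrite inE => /predU1P[->|/KP xP n m /K3K/xP//].
  exact: off_cycle_hom K3P fy.
have [S [SK SL]] := RK2; exists S; split=> [y yys|x xxs|x01 Sx0].
- by apply: hom_off_cycle => n m /SK; apply: K2y.
- by apply: hom_off_cycle => n m /SL/L21; apply: L1x.
by apply: (K0x x01); apply/L10/L21/SL.
Qed.
End Star.

(** * The amalgam *)

(** The quotient by the kernel is in bijection with the image, whose order is a power of [p] by
    Lagrange. *)
Lemma residually_finite_pgroup_hom (p : nat) (G : groupType) : prime p ->
  (forall g : G, g <> 1 -> exists (V : finGroupType) (f : {multiplicative G -> V}),
     p.-nat #|{: V}| /\ f g <> 1) -> residually_finite_pgroup p G.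
Proof.
move=> p_prime Gp g /Gp[V [f [pV fg]]].
have kerN : is_normal_subgroup [set x | f x = 1]%classic.
  split; first exact: hom_kernel_subgroup.
  by move=> x y /= fx; rewrite homJ fx conj1g.
pose N := NormalSubgroup kerN; exists N; split=> //.
pose I : {set V} := [set y | `[< exists x, f x = y >]]%SET.
have gI : group_set I.
  apply/group_setP; split; first by rewrite inE; apply/asboolP; exists 1; rewrite hom1.
  move=> x y; rewrite !inE => /asboolP[x' <-] /asboolP[y' <-]; apply/asboolP.
  by exists (x' * y'); rewrite gmulfM.
have /p_natP[n In] : p.-nat #|I|.
  apply: (@pnat_dvd _ #|{: V}|) pV; rewrite -[#|{: V}|]cardsT.
  exact: (@cardSg V (setT_group V) (group gI) (finset.subsetT _)).
exists n; rewrite -In.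
have fE (x : G) : f (repr (coset_class N x)) = f x.
  have /= := coset_class_reprP N x.
  by rewrite gmulfM homV => /mulg1_eq; rewrite invgK => ->.
have fI (a : quotientGroup N) : f (repr a) \in enum I.
  by rewrite mem_enum inE; apply/asboolP; exists (repr a).
apply/card_set_bijP; exists (fun a : quotientGroup N => index (f (repr a)) (enum I)).
split=> [a _ /=|a b _ _ /(congr1 (nth 1 (enum I)))|i /= iI].
- by rewrite cardE index_mem.
- rewrite !nth_index // => fab; rewrite -[a]coset_class_repr -[b]coset_class_repr.
  by apply/coset_classP => /=; rewrite gmulfM homV fab mulVg.
have : nth 1 (enum I) i \in I by rewrite -mem_enum mem_nth // -cardE.
rewrite inE => /asboolP[x fx]; exists (coset_class N x) => //.
by rewrite fE fx index_uniq ?enum_uniq // -cardE.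
Qed.

Lemma subgroup_generated_hom (G H : groupType) (D : set G)
    (f g : {multiplicative G -> H}) :
  (forall x, D x -> f x = g x) -> forall x, subgroup_generated D x -> f x = g x.
Proof.
move=> fg x /(_ [set y | f y = g y]%classic); apply; split=> //; split=> /=.
- by rewrite !hom1.
- by move=> y z fy fz; rewrite !gmulfM fy fz.
- by move=> y fy; rewrite !homV fy.
Qed.

Lemma subgroup_generated_subgroup (G : groupType) (D : set G) :
  is_subgroup (subgroup_generated D).
Proof.
split=> [B [[]]//|x y Dx Dy B BD|x Dx B BD].
  by have [[_ BM _] _] := BD; apply: BM; [apply: Dx|apply: Dy].
by have [[_ _ BV] _] := BD; apply: BV; apply: Dx.
Qed.

Lemma is_subgroup_in_cycle (G : groupType) (D : set G) x y :
  is_subgroup D -> D x -> in_cycle x y -> D y.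
Proof.
move=> [D1 DM DV] Dx [n [m ->]].
have DX i : D (x ^+ i) by elim: i => [//|i IHi]; rewrite expgS; apply: DM.
by apply: DM => //; apply: DV.
Qed.

Section EngelAmalgam.
Variables (Z : Type) (X Y : set Z).
Hypothesis disjXY : (X `&` Y = set0)%classic.
Hypothesis coverXY : (X `|` Y = setT)%classic.
Variables u v : freeGroup Z.
Hypothesis uX : subgroup_generated (@free_gen Z @` X)%classic u.
Hypothesis vY : subgroup_generated (@free_gen Z @` Y)%classic v.
Hypotheses (u_npp : ~ proper_power u) (v_npp : ~ proper_power v).
Variables (k : nat) (p : nat) (p_prime : prime p).

Local Notation A := (freeGroup Z).
Local Notation H := (engelGroup k).
Let uu (i : bool) : A := if i then u else v.
Let hh (i : bool) : H := if i then engel_a k else engel_b k.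
Let XY (i : bool) : set Z := if i then X else Y.
Let D (i : bool) := subgroup_generated (@free_gen Z @` XY i)%classic.

Let rel := left_normed_comm u (nseq k.+1 v).
Local Notation G := (presentedGroup [set rel]%classic).
Local Notation cls := (pres_class [set rel]%classic).

Let Duu i : D i (uu i). Proof. by case: i. Qed.
Let D_subgroup i : is_subgroup (D i). Proof. exact: subgroup_generated_subgroup. Qed.

Lemma center_hom : exists f : {multiplicative H -> G}, forall i, f (hh i) = cls (uu i).
Proof.
have [|f [fa fb]] := @engel_hom k G (cls u) (cls v).
  by rewrite -map_nseq -hom_left_normed pres_class_rel.
by exists f => -[].
Qed.

Variable iH : {multiplicative H -> G}.
Hypothesis iHE : forall i, iH (hh i) = cls (uu i).

(* A closed path [x0 y1 x1 ... yn xn] in the tree of groups: each syllable [(i, y, x)]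
   visits the leaf [i] at [y] and comes back to the center at [x]. *)
Implicit Types l : seq (bool * A * H).
Definition path_val l : G :=
  foldr (fun s g => cls s.1.2 * iH s.2 * g) 1 l.

Lemma path_val_cons i y x l :
  path_val ((i, y, x) :: l) = cls y * iH x * path_val l.
Proof. by []. Qed.

Fixpoint path_leaf l : Prop :=
  if l is (i, y, _) :: l' then D i y /\ path_leaf l' else True.

(** No backtracking in the tree: at a leaf always, at the center only when two successive visits go
    to the same leaf. *)
Fixpoint path_reduced l : Prop :=
  if l is (i, y, x) :: l' then
    [/\ ~ in_cycle (uu i) y,
        if l' is (j, _, _) :: _ then i = j -> ~ in_cycle (hh i) x else True &
        path_reduced l']
  else True.

Lemma path_onto (g : G) : exists x0 l, path_leaf l /\ g = iH x0 * path_val l.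
Proof.
have [w ->] := pres_class_onto g; elim/free_ind: w => [|a w [x0 [l [Dl e]]]].
  by exists 1, [::]; rewrite !hom1 mulg1.
have [i ai] : exists i, XY i a.1.
  have : (X `|` Y)%classic a.1 by rewrite coverXY.
  by case=> H; [exists true|exists false].
exists 1, ((i, word_class [:: a], x0) :: l); split; last first.
  by rewrite hom1 mul1g path_val_cons -mulgA -e gmulfM.
split=> //; rewrite word_class1.
have Da : D i (free_gen a.1) by move=> B [_]; apply; exists a.1.
by case: a {ai} Da => z [] //= Da; have [_ _ DV] := D_subgroup i; apply: DV.
Qed.

Lemma in_cycle_transfer i y : in_cycle (uu i) y ->
  exists z, cls y = iH z.
Proof.
move=> [n [m ->]]; exists (hh i ^+ n * hh i ^- m).
by rewrite !gmulfM !homV !homX iHE.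
Qed.

(** A leaf syllable in the amalgamated cycle is absorbed into the center; a central syllable in the
    cycle between two visits to one leaf merges them, and the merged syllable may be absorbed in
    turn. *)
Lemma path_reduce x0 l : path_leaf l -> exists x0' l',
  [/\ path_leaf l', path_reduced l' & iH x0 * path_val l = iH x0' * path_val l'].
Proof.
elim: l x0 => [|[[i y] x] l IHl] x0; first by exists x0, [::].
rewrite path_val_cons => -[Dy /(IHl x)[x1 [l1 [Dl1 rl1 e1]]]].
rewrite -(mulgA (cls y)) e1 {IHl e1 l x}.
have [[z ez]|nz] : (exists z, cls y = iH z) \/ ~ in_cycle (uu i) y.
  by have [/in_cycle_transfer|] := pselect (in_cycle (uu i) y); [left|right].
  by exists (x0 * z * x1), l1; split=> //; rewrite ez !gmulfM !mulgA.
case: l1 => [|[[j y'] x'] l2] in Dl1 rl1 *.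
  by exists x0, [:: (i, y, x1)]; rewrite !path_val_cons !mulgA.
have [[ij x1i]|nx1] := pselect (i = j /\ in_cycle (hh i) x1); last first.
  exists x0, [:: (i, y, x1), (j, y', x') & l2].
  by rewrite !path_val_cons !mulgA; split=> //; split=> // ij x1i; apply: nx1.
move: Dl1 rl1; rewrite -{j}ij => -[Dy' Dl2] [_ rj rl2].
have [c [ci ec]] : exists c, in_cycle (uu i) c /\ iH x1 = cls c.
  have [n [m ->]] := x1i; exists (uu i ^+ n * uu i ^- m); split; first by exists n, m.
  by rewrite !gmulfM !homV !homX iHE.
have Dy3 : D i (y * c * y').
  have [_ DM _] := D_subgroup i; do 2![apply: (DM) => //].
  exact: is_subgroup_in_cycle ci.
have e3 : iH x0 * (cls y * (iH x1 * path_val ((i, y', x') :: l2))) =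
    iH x0 * path_val ((i, y * c * y', x') :: l2).
  by rewrite !path_val_cons ec !gmulfM !mulgA.
have [/in_cycle_transfer[z ez]|nz3] := pselect (in_cycle (uu i) (y * c * y')).
  exists (x0 * z * x'), l2; split=> //.
  by rewrite e3 path_val_cons ez !gmulfM !mulgA.
by exists x0, ((i, y * c * y', x') :: l2).
Qed.

Section Evaluation.
Variable S : star_state p uu hh.
Variables (U : finGroupType) (f : bool * {set S} -> U).

Let C i : {group S} := <[star_center S (hh i)]>%G.
(** Being constant on left cosets of [C i], this function is fixed by right translation by [C i]. *)
Let s i : wreath U S := wreath_base (fun g : S => f (i, g *: C i)).

Lemma s_commute i : commute (wreath_top U S (star_center S (hh i))) (s i).
Proof.
apply: wreathP; last by rewrite !wreathM2 /= mulg1 mul1g.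
move=> g; rewrite !wreathM1 /= !ffunE mulg1 mul1g.
by rewrite lcosetM lcoset_id // cycle_id.
Qed.

Definition leaf_hom i : {multiplicative A -> wreath U S} :=
  comp_hom (conj_hom (s i)) (comp_hom (wreath_top U S) (star_leaf S i)).
Definition center_top : {multiplicative H -> wreath U S} :=
  comp_hom (wreath_top U S) (star_center S).

Lemma leaf_hom_uu i : leaf_hom i (uu i) = center_top (hh i).
Proof.
have -> : leaf_hom i (uu i) = (wreath_top U S (star_leaf S i (uu i))) ^ (s i) by [].
rewrite star_compat; exact/conjg_fixP/commgP/s_commute.
Qed.

(** Generators in [X] and in [Y] follow their own leaf. The relator dies because [u] and [v] go to
    the images of [engel_a] and [engel_b]. *)
Lemma eval_hom : exists theta : {multiplicative G -> wreath U S},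
  (forall i y, D i y -> theta (cls y) = leaf_hom i y) /\
  (forall x, theta (iH x) = center_top x).
Proof.
pose t := free_hom (fun z : Z => leaf_hom (`[< X z >]) (free_gen z)).
have tD i y : D i y -> t y = leaf_hom i y.
  apply: subgroup_generated_hom => _ [z iz <-]; rewrite free_hom_gen.
  case: i iz => /= iz; first by rewrite asboolT.
  rewrite asboolF // => Xz; have : (X `&` Y)%classic z by [].
  by rewrite disjXY.
have [|theta thetaE] := @pres_hom _ [set rel]%classic _ t.
  move=> _ ->; rewrite hom_left_normed map_nseq.
  rewrite (tD true u uX) (tD false v vY) (leaf_hom_uu true) (leaf_hom_uu false).
  rewrite -map_nseq -hom_left_normed.
  have -> : left_normed_comm (hh true) (nseq k.+1 (hh false)) = 1.
    exact: engel_c_last.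
  exact: hom1.
exists theta; split=> [i y Dy|x]; first by rewrite thetaE; apply: tD.
have [w ->] := pres_class_onto x.
apply: (@free_hom_ext _ _ (comp_hom (comp_hom theta iH) (pres_class _))
  (comp_hom center_top (pres_class _))) => i.
have : theta (iH (hh i)) = center_top (hh i).
  by rewrite iHE thetaE -leaf_hom_uu; apply: tD.
by case: i.
Qed.

(** The walk of the path in [S] from [g], recorded by the cosets of [C i] on entering and leaving
    each leaf: conjugation by [s i] contributes the inverse of the first value and then the
    second. *)
Fixpoint path_word (g : S) l : seq (bool * {set S} * bool) :=
  if l is (i, y, x) :: l' then
    [:: ((i, g *: C i), false), ((i, (g * star_leaf S i y) *: C i), true) &
     path_word (g * star_leaf S i y * star_center S x) l']
  else [::].

Lemma eval_path (theta : {multiplicative G -> wreath U S}) g l :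
  (forall i y, D i y -> theta (cls y) = leaf_hom i y) ->
  (forall x, theta (iH x) = center_top x) -> path_leaf l ->
  (theta (path_val l)).1 g = word_val f (path_word g l).
Proof.
move=> thetaD thetaH; elim: l g => [|[[i y] x] l IHl] g.
  by rewrite hom1 wreath11.
move=> [Dy Dl].
have -> : theta (path_val ((i, y, x) :: l)) =
    leaf_hom i y * center_top x * theta (path_val l).
  by rewrite path_val_cons !gmulfM (thetaD _ _ Dy) thetaH.
have l1 : (leaf_hom i y).1 g =
    (f (i, g *: C i))^-1 * f (i, (g * star_leaf S i y) *: C i).
  have -> : leaf_hom i y = (s i)^-1 * (wreath_top U S (star_leaf S i y) * s i) by [].
  rewrite !(wreathM1, wreathV1, wreathM2, wreathV2) /= !ffunE.
  by rewrite invg1 !mulg1 mul1g.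
have l2 : (leaf_hom i y).2 = star_leaf S i y.
  have -> : leaf_hom i y = (s i)^-1 * (wreath_top U S (star_leaf S i y) * s i) by [].
  by rewrite !(wreathM2, wreathV2) /= invg1 mulg1 mul1g.
have c1 w : (center_top x).1 w = 1 by rewrite ffunE.
have c2 : (center_top x).2 = star_center S x by [].
have mul3 (a b c : wreath U S) :
    (a * b * c).1 g = a.1 g * b.1 (g * a.2) * c.1 (g * a.2 * b.2).
  by rewrite !wreathM1 wreathM2 mulgA.
by rewrite mul3 l1 l2 c1 c2 IHl // mulg1 /= /letter_val /= !mulgA.
Qed.
End Evaluation.

Lemma cycle_in_cycle (W : finGroupType) (c x : W) : x \in <[c]> -> in_cycle c x.
Proof. by move=> /cycleP[n ->]; apply: in_cycle_expg. Qed.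

Lemma lcoset_eq_cycle (W : finGroupType) (c x y : W) :
  x *: <[c]> = (x * y) *: <[c]> -> in_cycle c y.
Proof.
move=> e; apply: cycle_in_cycle.
by have := lcoset_refl <[c]>%G (x * y); rewrite /= -e mem_lcoset mulKg.
Qed.

(** The two letters of a syllable differ as [y] stays outside the cycle in [S]; letters of
    successive syllables can cancel only at the same leaf, where [x] stays outside. *)
Lemma path_word_reduced (S : star_state p uu hh) (g : S) l :
  (forall i y x, (i, y, x) \in l ->
     ~ in_cycle (star_leaf S i (uu i)) (star_leaf S i y)) ->
  (forall i y x, (i, y, x) \in l -> ~ in_cycle (hh i) x ->
     ~ in_cycle (star_center S (hh i)) (star_center S x)) ->
  path_reduced l -> reduced (path_word g l).
Proof.
elim: l g => [//|[[i y] x] l IHl] g lP rP [_ rx rl].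
have {IHl rl} : reduced (path_word (g * star_leaf S i y * star_center S x) l).
  apply: IHl rl => [j y' x' jl|j y' x' jl]; [apply: (lP j y' x')|apply: (rP j y' x')].
    by rewrite inE jl orbT.
  by rewrite inE jl orbT.
have {}lP : ~ in_cycle (star_center S (hh i)) (star_leaf S i y).
  by have := lP i y x (mem_head _ _); rewrite star_compat.
have {}rP := rP i y x (mem_head _ _).
have n1 : non_inverse ((i, g *: <[star_center S (hh i)]>), false)
    ((i, (g * star_leaf S i y) *: <[star_center S (hh i)]>), true).
  by apply/asboolPn => -[/esym/lcoset_eq_cycle].
case: l rx => [|[[j y'] x'] l] rx; first by rewrite /reduced /= n1.
move=> rl; rewrite /reduced /= n1 /=; apply/andP; split; last exact: rl.
apply/asboolPn => -[ij]; rewrite ij => /esym/lcoset_eq_cycle.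
exact: (rP (rx (esym ij))).
Qed.

Lemma path_reduced_mem l i y x : path_reduced l -> (i, y, x) \in l ->
  ~ in_cycle (uu i) y.
Proof.
elim: l => [//|[[j y'] x'] l IHl] [nj _ rl]; rewrite inE => /predU1P[[-> -> _]//|].
exact: IHl.
Qed.

Lemma engel_amalgam_residually_p (g : G) : g <> 1 ->
  exists (V : finGroupType) (f : {multiplicative G -> V}), p.-nat #|{: V}| /\ f g <> 1.
Proof.
have [x00 [l0 [/path_reduce Dl0 ->]]] := path_onto g.
have [x0 [l [Dl rl ->]]] := Dl0 x00; move=> g1.
pose ys := [seq s.1 | s <- l].
pose xs := [seq x <- [seq (s.1.1, s.2) | s <- l] | `[< ~ in_cycle (hh x.1) x.2 >]].
have [||||||||S [Sy Sx Sx0]] := @star_separation p p_prime A H uu hh _ _ _ _ _ _ ys xs x0.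
- exact: free_residually_p.
- exact: engel_residually_p.
- by case=> n n0; apply: not_proper_power_expg_neq1.
- by case=> n n0; [apply: (engel_a_expg p_prime)|apply: (engel_b_expg p_prime)].
- by case=> x; apply: free_cycle_p_separable.
- by case=> x; [apply: engel_a_separable|apply: engel_b_separable].
- by move=> _ /mapP[[[i y] x] il ->] /=; apply: path_reduced_mem il.
- by move=> x; rewrite mem_filter => /andP[/asboolP].
have [l_nil|l_cons] := pselect (l = [::]).
  have x01 : x0 <> 1.
    by move=> x01; apply: g1; rewrite x01 l_nil hom1 mulg1.
  (* For an element of the center the top group [S] suffices, so the base is taken trivial. *)
  have [theta [_ thetaH]] := eval_hom (S := S) (fun=> ord0 : 'I_1).
  exists (wreath 'I_1 S), theta; split.
    by rewrite wreath_pnat ?star_pgroup // card_ord.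
  rewrite l_nil mulg1 thetaH => /(congr1 snd) e; exact: (Sx0 x01).
(* The initial central syllable has trivial base part and moves coordinate 1 to [star_center S x0],
   where the word starts. *)
have rw : reduced (path_word (star_center S x0) l).
  apply: path_word_reduced => // i y x il.
    by apply: (Sy (i, y)); apply/mapP; exists (i, y, x).
  move=> nx; apply: (Sx (i, x)); rewrite mem_filter asboolT //=.
  by apply/mapP; exists (i, y, x).
have [|U [f [pU fw]]] := reduced_p_separated p_prime rw.
  by case: (l) l_cons => [|[[i y] x] l'].
have [theta [thetaD thetaH]] := eval_hom f.
exists (wreath U S), theta; split; first by rewrite wreath_pnat ?star_pgroup.
move=> e; apply: fw; rewrite -(eval_path _ thetaD thetaH Dl).
have {}e : (theta (iH x0 * path_val l)).1 1 = 1 by rewrite e wreath11.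
have mul2 (a b : wreath U S) : (a * b).1 1 = a.1 1 * b.1 a.2.
  by rewrite wreathM1 mul1g.
have c1 : (center_top S U x0).1 1 = 1 by rewrite ffunE.
by move: e; rewrite gmulfM thetaH mul2 c1 mul1g.
Qed.
End EngelAmalgam.

Local Open Scope classical_set_scope.
Local Open Scope group_scope.

Theorem theorem2 (Z : Type) (X Y : set Z)
    (disjXY : X `&` Y = set0) (coverXY : X `|` Y = [set: Z])
    (u v : freeGroup Z)
    (uX : subgroup_generated (@free_gen Z @` X) u)
    (vY : subgroup_generated (@free_gen Z @` Y) v)
    (u_npp : ~ proper_power u) (v_npp : ~ proper_power v)
    (k : nat) (k_gt1 : (1 < k)%N) (p : nat) (p_prime : prime p) :
  residually_finite_pgroup p
    (presentedGroup [set left_normed_comm u (nseq k v)]).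
Proof.
case: k k_gt1 => // k0 _; have [iH iHE] := center_hom u v k0.
apply: residually_finite_pgroup_hom => // g.
exact: (engel_amalgam_residually_p disjXY coverXY uX vY u_npp v_npp p_prime iHE).
Qed.
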